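(* Let $r\ge1$ and let $\mu$ be a partition. The following identities hold in $\Lambda_{t,\theta}$. (1) (Down-up vertical $\imath$Pieri rule) $$V^{\imath}_\mu\cdot V^{\imath}_{(1^r)}=\sum_{a+b=r}\ \sum_{\lambda\stackrel{b}{\downarrow}\nu}\ \sum_{\mu\stackrel{a}{\downarrow}\nu}\theta^a\,\frac{b_\nu(t)}{b_\lambda(t)}\,\varphi_r(t)\,f^{\lambda}_{\nu,(1^b)}(t)\,f^{\mu}_{\nu,(1^a)}(t)\;V^{\imath}_\lambda ,$$ where $a,b\ge0$ and the inner sums run over all pairs of partitions $(\nu,\lambda)$ with $\mu\stackrel{a}{\downarrow}\nu$ and $\lambda\stackrel{b}{\downarrow}\nu$. (2) (Up-down vertical $\imath$Pieri rule) $$V^{\imath}_\mu\cdot V^{\imath}_{(1^r)}=\sum_{a+b=r}\ \sum_{i=0}^{\min(a,b)}\ \sum_{\xi\stackrel{a-i}{\downarrow}\lambda}\ \sum_{\xi\stackrel{b-i}{\downarrow}\mu}(-1)^i\,\theta^a\,t^{\frac{i(i-1)}{2}}\,\frac{\varphi_r(t)}{\varphi_i(t)}\,\frac{b_\mu(t)}{b_\xi(t)}\,f^{\xi}_{\lambda,(1^{a-i})}(t)\,f^{\xi}_{\mu,(1^{b-i})}(t)\;V^{\imath}_\lambda ,$$ where $a,b\ge0$ and the inner sums run over all pairs of partitions $(\xi,\lambda)$ with $\xi\stackrel{a-i}{\downarrow}\lambda$ and $\xi\stackrel{b-i}{\downarrow}\mu$.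
   Context: Let $t,\theta$ be indeterminates and $\Lambda_{t,\theta}=\mathbb{Q}(t)[\theta][v_1,v_2,\ldots]$ the polynomial ring in commuting variables $v_r$ ($r\ge1$). Set $v_0=1$, $v_a=0$ for $a<0$, and $v_\alpha=v_{\alpha_1}v_{\alpha_2}\cdots$ for an integer sequence $\alpha=(\alpha_1,\alpha_2,\ldots)$ with finitely many nonzero entries. For $1\le i<j$ the raising operator $R_{ij}$ sends $\alpha$ to $(\ldots,\alpha_i+1,\ldots,\alpha_j-1,\ldots)$ and the lowering operator $L_{ij}$ sends $\alpha$ to $(\ldots,\alpha_i-1,\ldots,\alpha_j-1,\ldots)$; they act by $R_{ij}v_\alpha=v_{R_{ij}\alpha}$, $L_{ij}v_\alpha=v_{L_{ij}\alpha}$ (products of operators are applied to the index sequence first, and only then is $v$ evaluated; all these operators commute). For an integer vector $\alpha$ define $$V^{\imath}_\alpha=\prod_{1\le i<j}\frac{1-\theta L_{ij}}{1-\theta tL_{ij}}\,\frac{1-R_{ij}}{1-tR_{ij}}\;v_\alpha,$$ where $\frac{1-u}{1-tu}$ is expanded as $1+(1-t^{-1})\sum_{s\ge1}t^su^s$; only finitely many terms are nonzero. For partitions, $\mu\stackrel{a}{\downarrow}\nu$ means $\nu_i\le\mu_i$ for all $i$ and $\mu-\nu$ is a vertical $a$-strip ($a$ boxes, at most one in each row). $\lambda'$ is the conjugate partition, $m_i(\lambda)$ the number of parts of $\lambda$ equal to $i$. Notation: $\varphi_r(t)=(1-t)(1-t^2)\cdots(1-t^r)$ for $r\ge0$ (so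 $\varphi_0=1$); $b_\lambda(t)=\prod_{i\ge1}\varphi_{m_i(\lambda)}(t)$; $\begin{bmatrix}n\\ r\end{bmatrix}_+(t)=\frac{(1-t^n)(1-t^{n-1})\cdots(1-t^{n-r+1})}{(1-t)(1-t^2)\cdots(1-t^r)}$ for $r\ge0$ and $0$ for $r<0$; and $$f^{\lambda}_{\mu,(1^m)}(t)=\prod_{i\ge1}\begin{bmatrix}\lambda_i'-\lambda_{i+1}'\\ \lambda_i'-\mu_i'\end{bmatrix}_+(t)$$ if $\lambda-\mu$ is a vertical $m$-strip, and $f^{\lambda}_{\mu,(1^m)}(t)=0$ otherwise. *)

(* Defs.v *)
From HB Require Import structures.
From mathcomp Require Import all_boot all_order all_algebra finmap zify.
From mathcomp Require Import boolp classical_sets cardinality fsbigop.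
From mathcomp Require Import monalg.

Set Implicit Arguments.
Unset Strict Implicit.
Unset Printing Implicit Defensive.

Import GRing.Theory.
Local Open Scope ring_scope.

Notation Qt := {fraction {poly rat}}.

Definition tvar : Qt := tofrac 'X.

Notation Qttheta := {poly Qt}.

Definition theta : Qttheta := 'X.

(* The n-th generator (counting from 0) of this polynomial algebra is v_(n+1). *)
Notation Lam := {malg Qttheta[{cmonom nat}]}.

Definition vgen (k : int) : Lam :=
  match k with
  | Posz 0 => 1
  | Posz n.+1 => << ucm n >>
  | Negz _ => 0
  end.

(* Integer sequences are indexed from 0: the entry alpha_(i+1) is [al i]. *)
Notation ivec := {fsfun nat -> int with 0}.

Definition vmon (al : ivec) : Lam := \prod_(i <- finsupp al) vgen (al i).

Record ipair := IPair { ipairval :> nat * nat; _ : (ipairval.1 < ipairval.2)%N }.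
HB.instance Definition _ := [isSub for ipairval].
HB.instance Definition _ := [Choice of ipair by <:].

Definition Rop (p : ipair) (al : ivec) : ivec :=
  [fsfun al with p.1 |-> al p.1 + 1, p.2 |-> al p.2 - 1].

Definition Lop (p : ipair) (al : ivec) : ivec :=
  [fsfun al with p.1 |-> al p.1 - 1, p.2 |-> al p.2 - 1].

(* A monomial in commuting operators Op_ij (i < j), given by its exponents. *)
Notation expo := {fsfun ipair -> nat with 0%N}.

Definition opmon (Op : ipair -> ivec -> ivec) (s : expo) (al : ivec) : ivec :=
  foldr (fun p be => iter (s p) (Op p) be) al (finsupp s).

(* The coefficient of X^s in (1 - c X) / (1 - c t X). *)
Definition gcoef (c : Qttheta) (s : nat) : Qttheta :=
  if s is 0 then 1 else (1 - tvar^-1)%:P * (tvar ^+ s)%:P * c ^+ s.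

Definition ecoef (c : Qttheta) (s : expo) : Qttheta :=
  \prod_(p <- finsupp s) gcoef c (s p).

(* The term of the fully expanded operator product acting on v_al that selects
   the monomials L^e.1 and R^e.2. *)
Definition VIterm (al : ivec) (e : expo * expo) : Lam :=
  (ecoef theta e.1 * ecoef 1 e.2) *: vmon (opmon Lop e.1 (opmon Rop e.2 al)).

(* [\sum_(_ \in _)] is 0 by convention on an infinite support;
   [VIterm_finite] below shows that the support is always finite. *)
Definition VI (al : ivec) : Lam :=
  \sum_(e \in [set: expo * expo]) VIterm al e.

Record intpart := IntPart {
  partval :> seq nat;
  _ : sorted geq partval && (0%N \notin partval)
}.
HB.instance Definition _ := [isSub for partval].
HB.instance Definition _ := [Choice of intpart by <:].

Definition ivec_of (la : seq nat) : ivec :=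
  [fsfun i in seq_fset tt (iota 0 (size la)) => (nth 0%N la i)%:Z].

(* [vstrip a mu nu]: nu is contained in mu and mu - nu is a vertical a-strip. *)
Definition vstrip (a : nat) (mu nu : seq nat) : Prop :=
  (forall i, nth 0 nu i <= nth 0 mu i <= (nth 0 nu i).+1)%N /\
  sumn mu = (sumn nu + a)%N.

(* The i-th part (i >= 1) of the conjugate partition. *)
Definition conjp (la : seq nat) (i : nat) : nat := count (leq i) la.

Definition phi (r : nat) : Qt := \prod_(1 <= k < r.+1) (1 - tvar ^+ k).

(* Factors with i > la_1 are phi 0 = 1. *)
Definition bpart (la : seq nat) : Qt :=
  \prod_(1 <= i < (head 0%N la).+1) phi (count_mem i la).

Definition qbin (n r : int) : Qt :=
  match r with
  | Posz r => (\prod_(k < r) (1 - tvar ^ (n - k%:Z))) /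
              (\prod_(1 <= k < r.+1) (1 - tvar ^+ k))
  | Negz _ => 0
  end.

(* f^la_(mu,(1^m)); when mu is contained in la, all factors with i > la_1
   are qbin 0 0 = 1. *)
Definition fcoef (la mu : seq nat) (m : nat) : Qt :=
  if `[< vstrip m la mu >] then
    \prod_(1 <= i < (head 0%N la).+1)
      qbin ((conjp la i)%:Z - (conjp la i.+1)%:Z)
           ((conjp la i)%:Z - (conjp mu i)%:Z)
  else 0.

(* The finitely supported sums over exponents and over vertical strips never
   fall back on the convention for infinite supports. *)
Section Finiteness.
Import Order.TTheory Num.Theory.

Let tail (m M : nat) (al : ivec) : int := \sum_(m <= k < M) al k.

Let tail_step (p : ipair) (d : int) (al : ivec) (m M : nat) :
  d <= 1 -> (p.2 < M)%N ->
  tail m M [fsfun al with p.1 |-> al p.1 + d, p.2 |-> al p.2 - 1]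
  <= tail m M al - (p.2 == m)%:Z.
Proof.
move=> d1 pM; have p12 : (p.1 < p.2)%N := valP p.
rewrite /tail (eq_bigr (fun k => al k + ((if k == p.1 then d else 0)
    + (if k == p.2 then -1 else 0)))); last first.
  move=> k _; rewrite !fsfun_withE.
  case: (eqVneq k p.1) => [->|_]; first by rewrite (ltn_eqF p12) addr0.
  by case: (eqVneq k p.2) => [->|_]; rewrite add0r ?addr0.
rewrite big_split lerD2l big_split /= -!big_mkcond !big_nat1_eq.
have [<-|mp] := eqVneq p.2 m; first by rewrite pM leqnn leqNgt p12 /= add0r.
by move: d1; do 2!case: ifP => //=; lia.
Qed.

Let tail_opmon (Op : ipair -> ivec -> ivec) (s : expo) (al : ivec) (M : nat)
    (q : ipair) :
  (forall (p : ipair) be m, (p.2 < M)%N ->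
     tail m M (Op p be) <= tail m M be - (p.2 == m)%:Z) ->
  (forall p, p \in finsupp s -> (p.2 < M)%N) ->
  tail q.2 M (opmon Op s al) <= tail q.2 M al - (s q)%:Z.
Proof.
move=> HOp Hs.
have iterP (p : ipair) n be : (p.2 < M)%N ->
    tail q.2 M (iter n (Op p) be) <= tail q.2 M be - (n * (p.2 == q.2))%N%:Z.
  move=> pM; elim: n => [|n IH] /=; first by rewrite mul0n subr0.
  apply: le_trans (HOp p _ q.2 pM) _; rewrite mulSn.
  by move: IH; case: eqP => _; lia.
have -> : s q = if q \in finsupp s then s q else 0%N.
  by case: ifPn => //; rewrite mem_finsupp negbK => /eqP.
have -> : (q \in finsupp s) = (q \in enum_fset (finsupp s)) by [].
have {}Hs p : p \in enum_fset (finsupp s) -> (p.2 < M)%N by apply: Hs.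
rewrite /opmon; have := fset_uniq (finsupp s); move: Hs.
elim: (enum_fset (finsupp s)) => [|p l IH] /= Hl; first by rewrite subr0.
move=> /andP[pl ul]; apply: le_trans (iterP p _ _ (Hl p (mem_head _ _))) _.
have Hl' p' : p' \in l -> (p'.2 < M)%N by move=> h; apply: Hl; rewrite inE h orbT.
move: (IH Hl' ul); rewrite inE; have [->|qp] /= := eqVneq q p.
  by rewrite (negPf pl) eqxx muln1; lia.
by case: (q \in l); case: eqP => _; lia.
Qed.

Let vmon_ge0 (al : ivec) (k : nat) : vmon al != 0 -> 0 <= al k.
Proof.
apply: contraNT; rewrite -ltNge => alk.
have kin : k \in finsupp al by rewrite mem_finsupp; case: eqP alk => [->|].
rewrite /vmon (big_fsetD1 k) //=.
by case: (al k) alk => // n _; rewrite mul0r.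
Qed.

Let expo_finite (X : {fset ipair}) (C : nat) :
  finite_set [set s : expo | forall q, s q != 0%N -> q \in X /\ (s q <= C)%N].
Proof.
pose g (f : {ffun X -> 'I_C.+1}) : expo := [fsfun x : X => f x : nat].
apply: (@sub_finite_set _ _ [set g f | f in setT]); last first.
  exact/finite_image/finite_finset.
move=> s /= Hs; exists [ffun x : X => inord (s (val x))] => //.
apply/fsfunP => q; rewrite /g fsfun_ffun.
case: insubP => [u _ <-|] /=; last first.
  by have [->//|/Hs[->]] := eqVneq (s q) 0%N.
rewrite ffunE inordK // ltnS; have [->//|/Hs[]//] := eqVneq (s (val u)) 0%N.
Qed.

Lemma VIterm_finite (al : ivec) :
  finite_set [set e : expo * expo | VIterm al e != 0].
Proof.
pose N := (\max_(k <- finsupp al) k).+1.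
pose C := (\sum_(k <- finsupp al) `|al k|)%N.
have alN k : (N <= k)%N -> al k = 0.
  move=> Nk; apply/eqP; apply: contraLR Nk; rewrite -mem_finsupp -ltnNge ltnS.
  by move=> kin; apply: (leq_bigmax_seq k).
have tailC m M : tail m M al <= C%:Z.
  rewrite /tail.
  apply: (@le_trans _ _ (\sum_(m <= k < M | k \in finsupp al) `|al k|)).
    rewrite [leRHS]big_mkcond; apply: ler_sum => k _.
    by case: ifPn => [_|]; rewrite ?ler_norm // mem_finsupp negbK => /eqP->.
  rewrite -big_filter (perm_big [seq k <- finsupp al | k \in index_iota m M]).
    rewrite big_filter big_mkcond /C (big_morph Posz PoszD (erefl 0)) ler_sum // => k _.
    by case: ifP.
  apply: uniq_perm; rewrite ?filter_uniq ?iota_uniq ?fset_uniq //.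
  by move=> k; rewrite !mem_filter andbC.
have tailN m M : (N <= m)%N -> tail m M al = 0.
  by move=> Nm; rewrite /tail big_nat_cond big1 // => k /andP[/andP[mk _] _];
    apply: alN; apply: leq_trans mk.
pose X : {fset ipair} :=
  seq_fset tt (pmap insub [seq (i, j) | i <- iota 0 N, j <- iota 0 N]).
have inX (q : ipair) : (q.2 < N)%N -> q \in X.
  move=> qN; have q12 : (q.1 < q.2)%N := valP q.
  rewrite seq_fsetE mem_pmap_sub; apply/allpairsP; exists (val q).
  by rewrite !mem_iota /= !add0n qN (ltn_trans q12 qN); split => //; case: (val q).
have E := expo_finite X C.
apply: sub_finite_set (finite_setX E E) => -[s s'] /= Hne.
have {Hne}: vmon (opmon Lop s (opmon Rop s' al)) != 0.
  by apply: contraNN Hne; rewrite /VIterm /= => /eqP->; rewrite scaler0.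
set be := opmon _ _ _ => bene.
pose M := (\max_(p <- (finsupp s `|` finsupp s')%fset) p.2).+1.
have MP (p : ipair) : p \in (finsupp s `|` finsupp s')%fset -> (p.2 < M)%N.
  by move=> pin; rewrite ltnS (leq_bigmax_seq p).
have bnd (q : ipair) : (s q)%:Z + (s' q)%:Z <= tail q.2 M al.
  have := @tail_opmon Rop s' al M q.
  have := @tail_opmon Lop s (opmon Rop s' al) M q.
  have : 0 <= tail q.2 M be by apply: sumr_ge0 => k _; apply: vmon_ge0.
  move=> h0 /(_ (fun p be' m => @tail_step p (-1) be' m M isT)) h1.
  move=> /(_ (fun p be' m => @tail_step p 1 be' m M isT)) h2.
  have {}h1 : tail q.2 M be <= tail q.2 M (opmon Rop s' al) - (s q)%:Z.
    by apply: h1 => p pin; apply: MP; rewrite inE pin.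
  have {}h2 : tail q.2 M (opmon Rop s' al) <= tail q.2 M al - (s' q)%:Z.
    by apply: h2 => p pin; apply: MP; rewrite inE pin orbT.
  by lia.
have fin (q : ipair) (n : nat) : n != 0%N -> n%:Z <= tail q.2 M al ->
    q \in X /\ (n <= C)%N.
  move=> n0 nt; split; last by rewrite -lez_nat (le_trans nt).
  by apply: inX; rewrite ltnNge; apply: contraNN n0 => /(tailN _ M) E0; lia.
by split=> q /fin; apply; apply: le_trans (bnd q); lia.
Qed.

Lemma intpart_finite (n : nat) : finite_set [set la : intpart | (sumn la <= n)%N].
Proof.
have P0 : sorted geq [::] && (0%N \notin [::]) by [].
pose g (f : 'I_n.+1 * {ffun 'I_n.+1 -> 'I_n.+1}) : intpart :=
  insubd (IntPart P0) (mkseq (fun i => f.2 (inord i) : nat) f.1).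
apply: (@sub_finite_set _ _ [set g f | f in setT]); last first.
  exact/finite_image/finite_finset.
move=> la /= Hla.
have szla : (size la <= n)%N.
  apply: leq_trans Hla; have /andP[_] := valP la; rewrite /=.
  elim: (partval la) => //= x l IH; rewrite inE negb_or => /andP[x0 /IH].
  by move: x0; lia.
have enl i : (nth 0%N la i <= n)%N.
  apply: leq_trans Hla; elim: (partval la) i => [|x l IH] [|i] //=.
    exact: leq_addr.
  by apply: leq_trans (IH i) _; exact: leq_addl.
exists (inord (size la), [ffun i : 'I_n.+1 => inord (nth 0%N la i)]) => //.
have E : mkseq (fun i => nat_of_ord
    ([ffun j : 'I_n.+1 => inord (nth 0%N la j) : 'I_n.+1] (inord i)))
    (size la) = la.
  rewrite -[RHS](mkseq_nth 0%N); apply/eq_in_map => i; rewrite mem_iota add0n.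
  move=> /= ilt; have iltn : (i < n.+1)%N by rewrite ltnS (leq_trans _ szla) // ltnW.
  by rewrite ffunE (inordK iltn) inordK // ltnS.
by apply/val_inj; rewrite /g [fst _]/= [snd _]/= inordK ?ltnS // E valKd.
Qed.

Lemma vstrip_finite_inner (a : nat) (mu : seq nat) :
  finite_set [set nu : intpart | vstrip a mu nu].
Proof.
apply: sub_finite_set (intpart_finite (sumn mu)) => nu [_ /= ->].
exact: leq_addr.
Qed.

Lemma vstrip_finite_outer (a : nat) (nu : seq nat) :
  finite_set [set la : intpart | vstrip a la nu].
Proof.
by apply: sub_finite_set (intpart_finite (sumn nu + a)) => la [_ /= ->].
Qed.
End Finiteness.

(* Main.v *)
(* Let v(w) = sum_n v_n w^n and F(x) = (1 - x) / (1 - t x). The V_la are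
   V_la = B_{la_1} B_{la_2} ... 1 for the vertex operator
   B(z) = sum_m B_m z^m = v(z) T(z), where T(z) is the ring morphism
   v(w) |-> F(theta z w) F(w / z) v(w). An antisymmetry of the two-row functions
   gives the straightening rule B_s B_{s+1} = t B_{s+1} B_s.
   Put E_r = V_{(1^r)} / phi_r and let D(u) be the ring morphism
   v(w) |-> (1 + u w) v(w). Then
     D(u) B(z) = (1 + u z) B(z) D(u),
     E(y) B(z) = (1 + y / z) (1 + theta y z) B(z) E(y),
   so multiplication by E(y) factors as U(y) D(theta y) with
   U(y) B(z) = (1 + y / z) B(z) U(y). Hence D removes and U adds vertical strips,
   the straightening rule turning the coefficients into t-binomials: this is the
   first identity. The second one follows from
   D(u) U(y) = (sum_n (u y)^n / phi_n) U(y) D(u), where the inverse of the scalar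
   series is sum_n (-1)^n t^(n (n - 1) / 2) (u y)^n / phi_n. *)
Require Import Defs.
From HB Require Import structures.
From mathcomp Require Import all_boot all_order all_algebra finmap zify ring.
From mathcomp Require Import boolp classical_sets cardinality fsbigop.
From mathcomp Require Import monalg.
Set Implicit Arguments.
Unset Strict Implicit.
Unset Printing Implicit Defensive.

Import GRing.Theory.
Local Open Scope ring_scope.

(** The delicate point is the relation between E(y) and B(z): E_r is only given as B_1^r 1 / phi_r,
    so the effect of T(z) on it is not visible. It comes from the functional equation (1 - theta
    y^2) E(t y) = v(-y) E(y). As F(- c u y) is the quotient of 1 + c u y by its value at t y, the
    substitution v(w) |-> F(c u w) v(w) divides the solution by 1 + c u y; solutions with constant
    term 1 are unique because every 1 - t^k with k > 0 is invertible. Hence T(z) E(y) = E(y) / ((1 +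
    theta y z) (1 + y / z)). The equation is proved in the same induction: known up to degree n, it
    determines how B_m acts on E_k for k <= n, and comparing with B_1 E_n = (1 - t^(n+1)) E_(n+1)
    gives degree n + 1. Identities between series are stated coefficientwise, with integer indices
    and a bound N past which the terms vanish. *)

(** * Strips in terms of multiplicities *)

(* A partition is encoded by the list [ms] of the multiplicities of its parts
   [size ms], ..., 2, 1, in this order. *)
Fixpoint choices (ms : seq nat) : seq (seq nat) :=
  if ms is m :: ms' then [seq j :: js | j <- iota 0 m.+1, js <- choices ms']
  else [:: [::]].

(* Lowering by 1 (resp. raising by 1) [js_i] of the [ms_i] parts equal to [i];
   [c] counts the parts that enter from above (resp. the new parts 1). *)
Fixpoint lower (c : nat) (ms js : seq nat) : seq nat :=
  if (ms, js) is (m :: ms', j :: js') then (m - j + c)%N :: lower j ms' js' else [::].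

Fixpoint raise_tail (c : nat) (ms js : seq nat) : seq nat :=
  if (ms, js) is (m :: ms', j :: js')
  then (m - j + head c js')%N :: raise_tail c ms' js' else [::].
Definition raise c ms js := head c js :: raise_tail c ms js.

Lemma mem_choices ms js : (js \in choices ms) =
  (size js == size ms) && all2 leq js ms.
Proof.
elim: ms js => [|m ms IH] [|j js] //.
  by apply/negbTE/negP => /allpairsPdep[? [? []]].
apply/allpairsPdep/andP => [[j' [js' [+ + [-> ->]]]]|[/eqP[sz] /andP[jm jsms]]].
  by rewrite IH mem_iota /= => jm /andP[/eqP-> ->]; rewrite -ltnS jm.
by exists j, js; rewrite IH mem_iota /= ltnS jm sz eqxx.
Qed.

Lemma choices_uniq ms : uniq (choices ms).
Proof.
elim: ms => [|m ms IH] //; apply: allpairs_uniq (iota_uniq 0 m.+1) IH _.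
by move=> [a b] [c d] _ _ [-> ->].
Qed.

Lemma size_lower c ms js : js \in choices ms -> size (lower c ms js) = size ms.
Proof.
elim: ms js c => [|m ms IH] [|j js] c //; rewrite mem_choices //=.
by case/andP=> /eqP[sz] /andP[_ jsms]; rewrite IH // mem_choices sz eqxx.
Qed.

Lemma size_raise_tail c ms js : js \in choices ms -> size (raise_tail c ms js) = size ms.
Proof.
elim: ms js c => [|m ms IH] [|j js] c //; rewrite mem_choices //=.
by case/andP=> /eqP[sz] /andP[_ jsms]; rewrite IH // mem_choices sz eqxx.
Qed.

Lemma big_choices (V : nmodType) m ms (F : seq nat -> V) :
  \sum_(js <- choices (m :: ms)) F js =
  \sum_(j < m.+1) \sum_(js <- choices ms) F ((j : nat) :: js).
Proof.
rewrite -(big_mkord xpredT (fun j => \sum_(js <- choices ms) F (j :: js))).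
rewrite /index_iota subn0; exact: big_allpairs_dep.
Qed.

Fixpoint mpart (ms : seq nat) : seq nat :=
  if ms is m :: ms' then nseq m (size ms').+1 ++ mpart ms' else [::].

(** * Vertex operators *)

(* [H f] substitutes [f(u w) v(w)] for the generating function [v(w)], with
   values in polynomials in [u]. *)
Section Vertex.
Context (K : comUnitRingType) (t th : K) (A : comAlgType K) (v : int -> A).
Context (H : (nat -> K) -> {rmorphism A -> {poly A}}).
Hypothesis v0 : v 0 = 1.
Hypothesis vN : forall n, v (Negz n) = 0.
Hypothesis HZ : forall f c x, H f (c *: x) = c%:A *: H f x.
Hypothesis Hv : forall f k s, f 0%N = 1 -> (H f (v k))`_s = f s *: v (k - s%:Z).
Hypothesis H0 : forall f x, f 0%N = 1 -> (H f x)`_0 = x.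
Hypothesis HC : forall f g a b x, f 0%N = 1 -> g 0%N = 1 ->
  (H f (H g x)`_b)`_a = (H g (H f x)`_a)`_b.
Hypothesis tU : forall k, 1 - t ^+ k.+1 \is a GRing.unit.
Hypothesis twoU : (2%:R : K) \is a GRing.unit.

Lemma v_lt0 k : (k < 0)%R -> v k = 0.
Proof. by case: k => // n _; apply: vN. Qed.

(** The coefficients of [(1 - c x) / (1 - c t x)], written with [t^s - t^(s-1)] so that no inverse
    of [t] is needed. *)
Definition gc (c : K) (s : nat) : K :=
  if s is s'.+1 then (t ^+ s - t ^+ s') * c ^+ s else 1.

Notation H1 := (H (gc 1)).
Notation Hth := (H (gc th)).

(** * Extracting coefficients from products with v(z) *)

Definition vcoef (m : int) (q : {poly A}) : A :=
  \sum_(i < size q) q`_i * v (m - i%:Z).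

Lemma vcoefE N m (q : {poly A}) : (size q <= N)%N ->
  vcoef m q = \sum_(i < N) q`_i * v (m - i%:Z).
Proof.
move=> leN; rewrite /vcoef -!(big_mkord xpredT (fun i => q`_i * v (m - i%:Z))).
rewrite [RHS](@big_cat_nat _ _ _ (size q)) //= [X in _ + X]big_nat_cond.
rewrite [X in _ + X]big1 ?addr0 // => i /andP[/andP[le _] _].
by rewrite nth_default // mul0r.
Qed.

Lemma vcoefD m : {morph vcoef m : p q / p + q}.
Proof.
move=> p q; set N := maxn (size p) (size q).
rewrite !(@vcoefE N) ?leq_maxl ?leq_maxr ?(leq_trans (size_polyD _ _)) //.
by rewrite -big_split; apply: eq_bigr => i _; rewrite coefD mulrDl.
Qed.

Lemma vcoef0 m : vcoef m 0 = 0.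
Proof. by rewrite /vcoef size_poly0 big_ord0. Qed.

Lemma vcoefC m c (p : {poly A}) : vcoef m (c%:P * p) = c * vcoef m p.
Proof.
rewrite !(@vcoefE (size p)) //; last by rewrite mul_polyC size_scale_leq.
by rewrite mulr_sumr; apply: eq_bigr => i _; rewrite coefCM mulrA.
Qed.

Lemma vcoefX m (p : {poly A}) : vcoef m ('X * p) = vcoef (m - 1) p.
Proof.
rewrite [LHS](@vcoefE (size p).+1); last first.
  by rewrite (leq_trans (size_polyMleq _ _)) // size_polyX.
rewrite big_ord_recl coefXM eqxx mul0r add0r; apply: eq_bigr => i _.
rewrite coefXM lift0 /=; congr (_ * v _); lia.
Qed.

(** Coefficient of [z^m] in [v(z) p] when the inner variable is [z] and the outer one is [1/z]:
    Laurent polynomials in [z] are thus handled by ordinary bivariate polynomials. *)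
Definition vcoef2 (m : int) (p : {poly {poly A}}) : A :=
  \sum_(j < size p) vcoef (m + j%:Z) p`_j.

Lemma vcoef2E N m (p : {poly {poly A}}) : (size p <= N)%N ->
  vcoef2 m p = \sum_(j < N) vcoef (m + j%:Z) p`_j.
Proof.
move=> leN; rewrite /vcoef2 -!(big_mkord xpredT (fun j => vcoef (m + j%:Z) p`_j)).
rewrite [RHS](@big_cat_nat _ _ _ (size p)) //= [X in _ + X]big_nat_cond.
rewrite [X in _ + X]big1 ?addr0 // => i /andP[/andP[le _] _].
by rewrite nth_default // vcoef0.
Qed.

Lemma vcoef2D m : {morph vcoef2 m : p q / p + q}.
Proof.
move=> p q; set N := maxn (size p) (size q).
rewrite !(@vcoef2E N) ?leq_maxl ?leq_maxr ?(leq_trans (size_polyD _ _)) //.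
by rewrite -big_split; apply: eq_bigr => i _; rewrite coefD vcoefD.
Qed.

Lemma vcoef20 m : vcoef2 m 0 = 0.
Proof. by rewrite /vcoef2 size_poly0 big_ord0. Qed.

Lemma vcoef2C m c (p : {poly {poly A}}) : vcoef2 m (c%:P%:P * p) = c * vcoef2 m p.
Proof.
rewrite !(@vcoef2E (size p)) //; last by rewrite mul_polyC size_scale_leq.
by rewrite mulr_sumr; apply: eq_bigr => i _; rewrite coefCM vcoefC.
Qed.

Lemma vcoef2X m (p : {poly {poly A}}) : vcoef2 m ('X * p) = vcoef2 (m + 1) p.
Proof.
rewrite [LHS](@vcoef2E (size p).+1); last first.
  by rewrite (leq_trans (size_polyMleq _ _)) // size_polyX.
rewrite big_ord_recl coefXM eqxx vcoef0 add0r; apply: eq_bigr => i _.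
rewrite coefXM lift0 /=; congr (vcoef _ _); lia.
Qed.

Lemma vcoef2XP m (p : {poly {poly A}}) : vcoef2 m ('X%:P * p) = vcoef2 (m - 1) p.
Proof.
rewrite !(@vcoef2E (size p)) //; last by rewrite mul_polyC size_scale_leq.
apply: eq_bigr => i _; rewrite coefCM vcoefX; congr (vcoef _ _); lia.
Qed.

Lemma vcoef2Xn m n (p : {poly {poly A}}) : vcoef2 m ('X^n * p) = vcoef2 (m + n%:Z) p.
Proof.
elim: n m => [|n IH] m; first by rewrite expr0 mul1r addr0.
by rewrite exprS -mulrA vcoef2X IH; congr (vcoef2 _ _); lia.
Qed.

Lemma vcoef2XPn m n (p : {poly {poly A}}) : vcoef2 m ('X%:P ^+ n * p) = vcoef2 (m - n%:Z) p.
Proof.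
elim: n m => [|n IH] m; first by rewrite expr0 mul1r subr0.
by rewrite exprS -mulrA vcoef2XP IH; congr (vcoef2 _ _); lia.
Qed.

Lemma vcoef2_sum m I (r : seq I) P (p : I -> {poly {poly A}}) :
  vcoef2 m (\sum_(i <- r | P i) p i) = \sum_(i <- r | P i) vcoef2 m (p i).
Proof. exact: (big_morph _ (vcoef2D m) (vcoef20 m)). Qed.

(* [TT] is the substitution [v(w) -> F(th z w) F(z' w) v(w)] with
   [F(x) = (1 - x) / (1 - t x)], where [z] is the inner and [z'] the outer
   variable. [B m x] is the coefficient of [z^m] in [v(z) TT x] at [z' = 1/z]. *)
Definition TT (x : A) : {poly {poly A}} := map_poly Hth (H1 x).
Definition B (m : int) (x : A) : A := vcoef2 m (TT x).

Definition TTc (a b : nat) (x : A) : A := (Hth (H1 x)`_b)`_a.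

Lemma TTcE a b x : TTc a b x = (TT x)`_b`_a.
Proof. by rewrite /TT coef_map. Qed.

Lemma TTD : {morph TT : x y / x + y}.
Proof. by move=> x y; rewrite /TT !rmorphD. Qed.

Lemma TTM : {morph TT : x y / x * y}.
Proof. by move=> x y; rewrite /TT !rmorphM. Qed.

Lemma TTZ c x : TT (c *: x) = c%:A%:P%:P * TT x.
Proof.
have HA f : H f c%:A = c%:A%:P by rewrite HZ rmorph1 alg_polyC.
by rewrite -[in LHS]mulr_algl TTM /TT HA map_polyC /= HA.
Qed.

Lemma BD m : {morph B m : x y / x + y}.
Proof. by move=> x y; rewrite /B TTD vcoef2D. Qed.

Lemma BZ m c x : B m (c *: x) = c *: B m x.
Proof. by rewrite /B TTZ vcoef2C mulr_algl. Qed.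

Lemma B0 m : B m 0 = 0.
Proof. by have := BZ m 0 0; rewrite !scale0r. Qed.

Lemma B_sum m I (r : seq I) P (p : I -> A) :
  B m (\sum_(i <- r | P i) p i) = \sum_(i <- r | P i) B m (p i).
Proof. exact: (big_morph _ (BD m) (B0 m)). Qed.

Lemma B1 m : B m 1 = v m.
Proof.
rewrite /B /TT !rmorph1 /vcoef2 size_poly1 big_ord1 coef1 /= /vcoef size_poly1 big_ord1.
by rewrite coef1 mul1r addr0 subr0.
Qed.

Lemma poly_sumE (R : nzRingType) N (p : {poly R}) : (size p <= N)%N ->
  p = \sum_(i < N) (p`_i)%:P * 'X^i.
Proof.
move=> le; under eq_bigr do rewrite mul_polyC; rewrite -poly_def.
apply/polyP => i; rewrite coef_poly; case: ltnP => // leNi.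
by rewrite nth_default // (leq_trans le).
Qed.

(** [T(z)] is multiplicative, so [B(z) (u x) = T(z)(u) B(z) x]. The exponent [b] belongs to [1/z]
    and therefore raises the index of [B]. *)
Lemma B_mul N m u x :
  (forall a b, (N <= a)%N -> TTc a b u = 0) ->
  (forall a b, (N <= b)%N -> TTc a b u = 0) ->
  B m (u * x) = \sum_(a < N) \sum_(b < N) TTc a b u * B (m - a%:Z + b%:Z) x.
Proof.
move=> Na Nb; have sz1 : (size (TT u) <= N)%N.
  by apply/leq_sizeP => b le; apply/polyP => a; rewrite -TTcE Nb // coef0.
have sz2 b : (size ((TT u)`_b)%R <= N)%N.
  by apply/leq_sizeP => a le; rewrite -TTcE Na.
rewrite /B TTM; have -> : TT u = \sum_(a < N) \sum_(b < N) (TTc a b u)%:P%:P * ('X%:P ^+ a * 'X^b).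
  rewrite {1}(poly_sumE sz1) exchange_big; apply: eq_bigr => b _ /=.
  rewrite {1}(poly_sumE (sz2 b)) rmorph_sum /= mulr_suml; apply: eq_bigr => a _.
  by rewrite -TTcE rmorphM /= rmorphXn /= mulrA.
rewrite mulr_suml vcoef2_sum; apply: eq_bigr => a _.
rewrite mulr_suml vcoef2_sum; apply: eq_bigr => b _.
by rewrite -!mulrA vcoef2C vcoef2XPn vcoef2Xn.
Qed.

Definition d (n : nat) : K := (n <= 1)%N%:R.
Definition D (a : nat) (x : A) : A := (H d x)`_a.

Lemma gc0 c : gc c 0 = 1. Proof. by []. Qed.

Lemma d0 : d 0 = 1. Proof. by []. Qed.

Lemma TTc_v a b k :
  TTc a b (v k) = (gc th a * gc 1 b) *: v (k - a%:Z - b%:Z).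
Proof.
rewrite /TTc Hv ?gc0 // HZ coefZ mulr_algl Hv // scalerA mulrC.
by congr (_ *: v _); lia.
Qed.

(** Moving one [v k] out of [B] produces the index changes of the powers of one lowering and one
    raising operator; this is what later identifies [B] with the operator product. *)
Lemma B_v_mul m (k : int) x N : (k < N%:Z)%R ->
  B m (v k * x) = \sum_(a < N) \sum_(b < N)
    (gc th a * gc 1 b) *: (v (k - a%:Z - b%:Z) * B (m - a%:Z + b%:Z) x).
Proof.
move=> kN; rewrite (@B_mul N) => [|a b Na|a b Nb].
- by do 2!apply: eq_bigr => ? _; rewrite TTc_v scalerAl.
- by rewrite TTc_v v_lt0 ?scaler0 //; lia.
- by rewrite TTc_v v_lt0 ?scaler0 //; lia.
Qed.

Lemma TTc0 a b : TTc a b 0 = 0.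
Proof. by rewrite /TTc rmorph0 coef0 rmorph0 coef0. Qed.

Lemma TTc_fin x : exists N, forall a b, (N <= a)%N || (N <= b)%N -> TTc a b x = 0.
Proof.
exists (maxn (size (TT x)) (\max_(j < size (TT x)) size ((TT x)`_j)%R)) => a b.
rewrite !geq_max TTcE; case: (ltnP b (size (TT x))) => [bx|xb _]; last first.
  by rewrite [(TT x)`_b]nth_default // coef0.
rewrite andFb orbF => /andP[_ le].
by apply: nth_default; apply: leq_trans le; apply: (leq_bigmax (Ordinal bx)).
Qed.

Lemma B_coef N x m : (forall a b, (N <= a)%N || (N <= b)%N -> TTc a b x = 0) ->
  B m x = \sum_(a < N) \sum_(b < N) TTc a b x * v (m - a%:Z + b%:Z).
Proof.
move=> xN; rewrite -{1}[x]mulr1 (@B_mul N) => [|a b le|a b le]; last 2 first.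
- by rewrite xN ?le.
- by rewrite xN ?le ?orbT.
by do 2!apply: eq_bigr => ? _; rewrite B1.
Qed.

(** * The straightening rule for two vertex operators *)

Lemma TTcC a b c e x : TTc a b (TTc c e x) = TTc c e (TTc a b x).
Proof.
rewrite /TTc (HC b c) ?gc0 // (HC a c) ?gc0 // (HC b e) ?gc0 //.
by rewrite (HC a e) ?gc0.
Qed.

Lemma D_TTc a b c x : D a (TTc b c x) = TTc b c (D a x).
Proof. by rewrite /D /TTc (HC a b) ?gc0 ?d0 // (HC a c) ?gc0 ?d0. Qed.

(** The identity [(1 - t x) F(x) = 1 - x], cut off after [M] with its boundary term. *)
Lemma gc_telescope (P : nat -> A) M :
  \sum_(b < M.+1) gc 1 b *: P b - t *: \sum_(b < M.+1) gc 1 b *: P b.+1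
  = P 0%N - P 1%N - gc 1 M.+1 *: P M.+1.
Proof.
elim: M => [|M IH].
  rewrite !big_ord1 /= !scale1r !expr1 expr0 !mulr1 scalerBl scale1r.
  by rewrite opprB addrA subrK.
rewrite big_ord_recr [X in _ - _ *: X]big_ord_recr /= scalerDr opprD addrACA IH.
rewrite addrA subrK scalerA; congr (_ - _ *: _).
by rewrite !expr1n !mulr1 mulrBr -!exprS.
Qed.

(* The two-row function: [B m (v n) = V2 N m n] for [N] large. *)
Definition V2 (N : nat) (m n : int) : A := \sum_(a < N) \sum_(b < N)
    (gc th a * gc 1 b) *: (v (n - a%:Z - b%:Z) * v (m - a%:Z + b%:Z)).

(** This combination cancels the denominator of the raising factor and leaves its numerator, a
    difference of two products of [v] that the exchange of [m] and [n] swaps. The factor with [th]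
    shifts both rows equally, so it does not disturb the antisymmetry. *)
Lemma V2_antisym N (m n : int) : (n < N%:Z)%R -> (m < N%:Z)%R ->
  V2 N (m - 1) n - t *: V2 N m (n - 1)
   = - (V2 N (n - 1) m - t *: V2 N n (m - 1)).
Proof.
have key (p q : int) : (q < N%:Z)%R ->
   V2 N (p - 1) q - t *: V2 N p (q - 1) = \sum_(a < N) gc th a *:
      (v (q - a%:Z) * v (p - 1 - a%:Z) - v (q - 1 - a%:Z) * v (p - a%:Z)).
  move=> qN; rewrite /V2 scaler_sumr -sumrB; apply: eq_bigr => a _.
  pose P b := v (q - a%:Z - b%:Z) * v (p - 1 - a%:Z + b%:Z).
  have := gc_telescope P N.-1; rewrite prednK; last exact: leq_ltn_trans (leq0n a) (ltn_ord a).
  have -> : P N = 0 by rewrite /P v_lt0 ?mul0r //; lia.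
  rewrite scaler0 subr0 /P => E.
  transitivity (gc th a *: (P 0%N - P 1%N)); last first.
    by rewrite /P; congr (_ *: (v _ * v _ - v _ * v _)); lia.
  rewrite -E scalerBr scalerA mulrC -scalerA !scaler_sumr.
  congr (_ - _); apply: eq_bigr => b _; first by rewrite scalerA.
  by rewrite -scalerA; congr (_ *: (_ *: (_ *: (v _ * v _)))); lia.
move=> nN mN; rewrite !key // -sumrN; apply: eq_bigr => a _.
by rewrite -scalerN opprB; congr (_ *: (_ - _)); rewrite mulrC.
Qed.

(** Reduces two vertex operators on any [x] to two-row functions. By [TTcC] the coefficients are
    symmetric under exchanging the pairs [(i, j)] and [(k, l)]. *)
Lemma BB_coef x : exists N1, forall N2 (m n : int), (n + N1%:Z < N2%:Z)%R ->
  B m (B n x) = \sum_(i < N1) \sum_(j < N1) \sum_(k < N1) \sum_(l < N1)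
    TTc k l (TTc i j x) * V2 N2 (m - k%:Z + l%:Z) (n - i%:Z + j%:Z).
Proof.
have [N1 xN] := TTc_fin x; exists N1 => N2 m n nN.
rewrite [B n x](B_coef _ xN) B_sum; apply: eq_bigr => i _.
rewrite B_sum; apply: eq_bigr => j _; rewrite mulrC (@B_v_mul _ _ _ N2); last first.
  by have := ltn_ord j; lia.
have yN k l : (N1 <= k)%N || (N1 <= l)%N -> TTc k l (TTc i j x) = 0.
  by move=> kl; rewrite TTcC xN // TTc0.
under eq_bigr do under eq_bigr do rewrite (B_coef _ yN) mulr_sumr scaler_sumr.
under eq_bigr do rewrite exchange_big.
rewrite exchange_big; apply: eq_bigr => k _ /=.
under eq_bigr do under eq_bigr do rewrite mulr_sumr scaler_sumr.
under eq_bigr do rewrite exchange_big.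
rewrite exchange_big; apply: eq_bigr => l _ /=.
rewrite /V2 mulr_sumr; apply: eq_bigr => a _; rewrite mulr_sumr; apply: eq_bigr => b _.
rewrite -scalerAr; congr (_ *: _); rewrite mulrCA; congr (_ * (_ * v _)); lia.
Qed.

(** The difference of the sides is a sum of symmetric coefficients times antisymmetric functions,
    hence equals its own negative; this is where [2] has to be invertible. *)
Lemma BB_straighten s x : B s (B (s + 1) x) = t *: B (s + 1) (B s x).
Proof.
apply/eqP; rewrite -subr_eq0; set y := _ - _.
suff yy : y = - y.
  have y2 : (2%:R : K) *: y = 0 by rewrite scaler_nat mulr2n {1}yy addNr.
  by rewrite -(scale1r y) -(mulVr twoU) -scalerA y2 scaler0.
(* [N2] exceeds [s + 1] plus any shift below [N1], as both [BB_coef] and [V2_antisym] demand. *)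
have [N1 xN] := BB_coef x; pose N2 := (`|s| + 2 * N1 + 3)%N.
pose G k l i j := V2 N2 (s - k%:Z + l%:Z) (s + 1 - i%:Z + j%:Z)
      - t *: V2 N2 (s + 1 - k%:Z + l%:Z) (s - i%:Z + j%:Z).
have Ganti k l i j : (k < N1)%N -> (l < N1)%N -> (i < N1)%N -> (j < N1)%N ->
    G k l i j = - G i j k l.
  move=> kN lN iN jN.
  have := @V2_antisym N2 (s + 1 - k%:Z + l%:Z) (s + 1 - i%:Z + j%:Z).
  rewrite /G.
  have -> : s + 1 - k%:Z + l%:Z - 1 = s - k%:Z + l%:Z by lia.
  have -> : s + 1 - i%:Z + j%:Z - 1 = s - i%:Z + j%:Z by lia.
  by apply; lia.
have yE : y = \sum_(i < N1) \sum_(j < N1) \sum_(k < N1) \sum_(l < N1)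
    TTc k l (TTc i j x) * G k l i j.
  rewrite /y !(xN N2) //; try lia.
  rewrite scaler_sumr -sumrB; apply: eq_bigr => i _.
  rewrite scaler_sumr -sumrB; apply: eq_bigr => j _.
  rewrite scaler_sumr -sumrB; apply: eq_bigr => k _.
  rewrite scaler_sumr -sumrB; apply: eq_bigr => l _.
  by rewrite mulrBr -scalerAr.
have yE' : y = \sum_(k < N1) \sum_(l < N1) \sum_(i < N1) \sum_(j < N1)
    TTc k l (TTc i j x) * G k l i j.
  rewrite yE; under eq_bigr do rewrite exchange_big.
  rewrite exchange_big; apply: eq_bigr => k _ /=.
  under eq_bigr do rewrite exchange_big.
  by rewrite exchange_big.
rewrite {1}yE' yE -sumrN; apply: eq_bigr => k _ /=.
rewrite -sumrN; apply: eq_bigr => l _ /=.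
rewrite -sumrN; apply: eq_bigr => i _ /=; rewrite -sumrN; apply: eq_bigr => j _ /=.
by rewrite TTcC Ganti // mulrN.
Qed.

(** Extension by 0 to negative degrees, so that relations with a shift [k - 1] hold for all integers
    [k]. *)
Definition ext (f : nat -> A -> A) (k : int) (x : A) : A :=
  if k is Posz n then f n x else 0.

Lemma ext_lt0 f k x : (k < 0)%R -> ext f k x = 0.
Proof. by case: k. Qed.

Notation Di := (ext D).

(** * The strip-removing operator D *)

Lemma Hd_v k : H d (v k) = (v k)%:P + (v (k - 1))%:P * 'X.
Proof.
apply/polyP => s; rewrite Hv ?d0 // coefD coefC coefMX coefC /d.
by case: s => [|[|s]] /=; rewrite ?subr0 ?addr0 ?add0r ?scale0r ?scale1r.
Qed.

Lemma D_v_mul a k x : D a (v k * x) = v k * D a x + v (k - 1) * Di (a%:Z - 1) x.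
Proof.
rewrite /D rmorphM /= Hd_v mulrDl coefD coefCM -mulrA coefCM coefXM.
by case: a => [|a] /=; rewrite ?subn1.
Qed.

Lemma D_D a b x : D a (D b x) = D b (D a x).
Proof. by rewrite /D HC ?d0. Qed.

Lemma DD a : {morph D a : x y / x + y}.
Proof. by move=> x y; rewrite /D rmorphD coefD. Qed.

Lemma DZ a c x : D a (c *: x) = c *: D a x.
Proof. by rewrite /D HZ coefZ mulr_algl. Qed.

Lemma D0x a : D a 0 = 0.
Proof. by rewrite /D rmorph0 coef0. Qed.

Lemma D_sum a I (r : seq I) P (p : I -> A) :
  D a (\sum_(i <- r | P i) p i) = \sum_(i <- r | P i) D a (p i).
Proof. exact: (big_morph _ (DD a) (D0x a)). Qed.

Lemma D_one a : D a 1 = (a == 0%N)%:R.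
Proof. by rewrite /D rmorph1 coef1. Qed.

Lemma D_0 x : D 0 x = x.
Proof. exact: H0 d0. Qed.

Lemma TTc_Di a b k x : Di k (TTc a b x) = TTc a b (Di k x).
Proof. by case: k => k /=; rewrite ?TTc0 ?D_TTc. Qed.

(** [D(u)] commutes with the coefficients of [T(z)], so only the factor [v(z)] of [B(z)] contributes
    [1 + u z]. *)
Lemma D_B a m x : D a (B m x) = B m (D a x) + B (m - 1) (Di (a%:Z - 1) x).
Proof.
(* One bound serves all three expansions: the coefficients of [T] on [D a x] are images under [D a]
   of those on [x]. *)
have [N xN] := TTc_fin x; rewrite !(@B_coef N) //.
- rewrite D_sum -big_split; apply: eq_bigr => i _ /=.
  rewrite D_sum -big_split; apply: eq_bigr => j _ /=.
  rewrite mulrC D_v_mul TTc_Di D_TTc ![_ * TTc _ _ _]mulrC.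
  by congr (_ + _ * v _); lia.
- by move=> i j ij; rewrite -TTc_Di xN //; case: (_ - 1) => //= ?; rewrite D0x.
- by move=> i j ij; rewrite -D_TTc xN ?D0x.
Qed.

Lemma Di_B k m x : Di k (B m x) = B m (Di k x) + B (m - 1) (Di (k - 1) x).
Proof.
case: k => k; first exact: D_B.
by rewrite !ext_lt0 ?B0 ?addr0 //; lia.
Qed.

(** * The series E(y) and its relation to B(z) *)

Definition ph (r : nat) : K := \prod_(1 <= k < r.+1) (1 - t ^+ k).

Lemma ph0 : ph 0 = 1. Proof. by rewrite /ph big_geq. Qed.

Lemma phS r : ph r.+1 = ph r * (1 - t ^+ r.+1).
Proof. by rewrite /ph big_nat_recr. Qed.

Lemma phU r : ph r \is a GRing.unit.
Proof. by elim: r => [|r IH]; rewrite ?ph0 ?unitr1 // phS unitrM IH tU. Qed.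

Definition E (r : nat) : A := (ph r)^-1 *: iter r (B 1) 1.
Definition Ei (k : int) : A := if k is Posz n then E n else 0.

Lemma Ei_lt0 k : (k < 0)%R -> Ei k = 0.
Proof. by case: k. Qed.

Lemma E0 : E 0 = 1.
Proof. by rewrite /E ph0 invr1 scale1r. Qed.

Lemma B1_E r : B 1 (E r) = (1 - t ^+ r.+1) *: E r.+1.
Proof.
rewrite /E BZ scalerA phS invrM ?phU // mulrA divrr ?mul1r //.
Qed.

(** Coefficient of [y^k z^m] in [a(y) w(z) / (1 + y/z)], truncated at [N]. For [m = 0] and [w]
    supported on nonnegative indices it is the coefficient of [y^k] in [a(y) w(-y)]. *)
Definition conv (R : comNzRingType) (N : nat) (a w : int -> R) (k m : int) : R :=
  \sum_(b < N) (-1) ^+ b * (a (k - b%:Z) * w (m + b%:Z)).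

Lemma conv_recl (R : comNzRingType) N (a w : int -> R) k m :
  conv N.+1 a w k m = a k * w m - conv N a w (k - 1) (m + 1).
Proof.
rewrite /conv big_ord_recl expr0 mul1r subr0 addr0 -sumrN; congr (_ + _).
apply: eq_bigr => b _; rewrite lift0 exprS mulN1r mulNr.
by congr (- (_ * (a _ * w _))); lia.
Qed.

Lemma convS (R : comNzRingType) N (a w : int -> R) (k m : int) :
  (forall j : int, (j < 0)%R -> a j = 0) -> (k < N%:Z)%R ->
  conv N.+1 a w k m = conv N a w k m.
Proof.
move=> aN kN; rewrite /conv big_ord_recr /= aN ?mul0r ?mulr0 ?addr0 //; lia.
Qed.

Lemma conv_morph (R S : comNzRingType) (f : {rmorphism R -> S}) N a w k m :
  f (conv N a w k m) = conv N (f \o a) (f \o w) k m.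
Proof.
by rewrite rmorph_sum; apply: eq_bigr => b _; rewrite rmorphM rmorph_sign rmorphM.
Qed.

Lemma conv_shiftl (R : comNzRingType) N (a w : int -> R) k m :
  conv N (fun j => a (j - 1)) w k m = conv N a w (k - 1) m.
Proof. by apply: eq_bigr => b _; congr (_ * (a _ * _)); lia. Qed.

Lemma conv_shiftr (R : comNzRingType) N (a w : int -> R) k m :
  conv N a (fun j => w (j - 1)) k (m + 1) = conv N a w k m.
Proof. by apply: eq_bigr => b _; congr (_ * (_ * w _)); lia. Qed.

Lemma conv_linl (R : comNzRingType) N (a a' w : int -> R) c k m :
  conv N (fun j => a j + c * a' j) w k m = conv N a w k m + c * conv N a' w k m.
Proof. by rewrite /conv mulr_sumr -big_split; apply: eq_bigr => b _ /=; ring. Qed.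

Lemma conv_linr (R : comNzRingType) N (a w w' : int -> R) c k m :
  conv N a (fun j => w j + c * w' j) k m = conv N a w k m + c * conv N a w' k m.
Proof. by rewrite /conv mulr_sumr -big_split; apply: eq_bigr => b _ /=; ring. Qed.

Notation EV N := (conv N Ei v).

(** The coefficient of [y^k] in [E(y) v(-y) = (1 - th y^2) E(t y)]. The absolute values differ from
    the true exponents only where [Ei] vanishes. *)
Definition E_recurrence (k : int) := forall N, (k < N%:Z)%R ->
  EV N k 0 = t ^+ `|k|%N *: Ei k - (th * t ^+ `|(k - 2)%R|%N) *: Ei (k - 2).

Lemma E_recurrence_lt0 k : (k < 0)%R -> E_recurrence k.
Proof.
move=> k0 N _; rewrite !Ei_lt0 ?scaler0 ?subr0; try lia.
by apply: big1 => b _; rewrite Ei_lt0 ?mul0r ?mulr0 //; lia.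
Qed.

Local Notation "c %:K" := (c%:A : A)%:P (at level 2, format "c %:K").

(** The substitution [v(w) |-> F(c u w) v(w)] with its denominator [1 - t c u w] cleared. *)
Lemma H_gc_v c k : H (gc c) (v k) - (t * c)%:K * 'X * H (gc c) (v (k - 1))
  = (v k)%:P - c%:K * 'X * (v (k - 1))%:P.
Proof.
apply/polyP => s; rewrite !coefB -!mulrA !coefCM !coefXM Hv ?gc0 // coefC.
case: s => [|s]; first by rewrite /= !mulr0 scale1r !subr0.
rewrite /= Hv ?gc0 // coefC !mulr_algl.
have -> : k - 1 - s%:Z = k - s.+1%:Z by lia.
rewrite scalerA -scalerBl.
case: s => [|s].
  rewrite /= !expr1 expr0 mulr1 mulrBl mul1r (_ : _ - _ = - c) ?scaleNr ?sub0r //.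
  by ring.
rewrite [X in X *: _](_ : _ = 0); last by rewrite /= !exprS; ring.
by rewrite /= scale0r scaler0 subr0.
Qed.

Lemma HZK f c x : H f (c *: x) = c%:K * H f x.
Proof. by rewrite HZ mul_polyC. Qed.

Lemma KM c c' : (c * c')%:K = c%:K * c'%:K.
Proof. by rewrite -polyCM -scalerAl mul1r scalerA. Qed.

Lemma K1 : 1%:K = 1. Proof. by rewrite scale1r polyC1. Qed.

Lemma KB c c' : (c - c')%:K = c%:K - c'%:K.
Proof. by rewrite scalerBl polyCB. Qed.

Lemma signZ n (x : A) : (-1) ^+ n *: x = (-1) ^+ n * x.
Proof. by rewrite -(signr_odd K) -(signr_odd A) scaler_sign mulr_sign. Qed.

(* The series [sum_k Ei k y^k] is sent by [H (gc c)] to its quotient by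
   [1 + c u y]: both satisfy the recurrence, which determines the term of
   degree [k > 0] since [1 - t^k] is invertible. *)
Section RecurrenceUpTo.
Variable r : int.
Hypothesis recr : forall k : int, (k <= r)%R -> E_recurrence k.

Lemma H_Ei c (k : int) : (k <= r)%R ->
  H (gc c) (Ei k) + c%:K * 'X * H (gc c) (Ei (k - 1)) = (Ei k)%:P.
Proof.
set f := gc c; pose a := H f \o Ei; pose Ak (k : int) := a k + c%:K * 'X * a (k - 1).
have aN (j : int) : (j < 0)%R -> a j = 0.
  by move=> j0; rewrite /a /= Ei_lt0 ?rmorph0.
have AkN (j : int) : (j < 0)%R -> Ak j = 0.
  by move=> j0; rewrite /Ak !aN ?mulr0 ?addr0 //; lia.
rewrite -[H f _]/(a k) -[H f _]/(a (k - 1)) -/(Ak k).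
have [n] := ubnP `|k|%N; elim: n k => // n IH k kn kr.
have [k0|k0] : (k < 0)%R \/ (0 <= k)%R by lia.
  by rewrite AkN // Ei_lt0 ?polyC0.
have [->|kn0] := eqVneq k 0.
  by rewrite /Ak /a /= E0 !rmorph0 rmorph1 mulr0 addr0.
pose N := `|k|.+1%N.
(* [Ak] holds the coefficients of [(1 + c u y)] times the image of [E(y)]. Multiplying the image of
   the functional equation by [1 + t c u y], that is, combining degrees [k] and [k - 1], restores
   the original [v] and shows that [Ak] solves the same equation as [E]. *)
have Akrec : conv N.+1 Ak (polyC \o v) k 0
    = (t ^+ `|k|%N)%:K * Ak k - (th * t ^+ `|(k - 2)%R|%N)%:K * Ak (k - 2).
  have /(congr1 (H f)) := recr kr (N := N.+1) ltac:(lia).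
  have kr' : (k - 1 <= r)%R by lia.
  have /(congr1 (H f)) := recr kr' (N := N) ltac:(lia).
  rewrite !conv_morph !rmorphB !HZK -!/(a _).
  have -> : k - 1 - 2 = k - 2 - 1 by lia.
  have tk : (t ^+ `|k|)%:K = t%:K * (t ^+ `|(k - 1)%R|)%:K.
    by rewrite -KM -exprS; congr ((_ ^+ _)%:K); lia.
  (* For [k < 3] the exponents do not match, but then [a (k - 2 - 1)] is 0. *)
  have tk2 : t%:K * (th * t ^+ `|(k - 2 - 1)%R|)%:K * a (k - 2 - 1)
       = (th * t ^+ `|(k - 2)%R|)%:K * a (k - 2 - 1).
    have [k2|k2] : (k - 2 - 1 < 0)%R \/ (0 <= k - 2 - 1)%R by lia.
      by rewrite aN ?mulr0.
    by rewrite -KM mulrCA -exprS; congr ((_ * _ ^+ _)%:K * _); lia.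
  have aE j : H f (Ei j) = a j by [].
  rewrite !aE => E2 E1.
  have -> : conv N.+1 Ak (polyC \o v) k 0
      = conv N.+1 a (H f \o v) k 0 + (t * c)%:K * 'X * conv N a (H f \o v) (k - 1) 0.
    transitivity (conv N.+1 a
       (fun j => (H f \o v) j + - ((t * c)%:K * 'X) * (H f \o v) (j - 1)) k 0).
      transitivity (conv N.+1 a
        (fun j => (polyC \o v) j + - (c%:K * 'X) * (polyC \o v) (j - 1)) k 0).
        rewrite conv_linl conv_shiftl conv_linr
          (conv_recl _ a (fun j => (polyC \o v) (j - 1))) /=.
        rewrite (v_lt0 (k := 0 - 1)) // mulr0 sub0r (conv_shiftr N a (polyC \o v)).
        by rewrite [conv N.+1 a _ (k - 1) _]convS //; [ring|lia].
      by apply: eq_bigr => b _; rewrite /= !mulNr H_gc_v.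
    rewrite conv_linr (conv_recl _ a (fun j => (H f \o v) (j - 1))) /= (v_lt0 (k := 0 - 1)) // rmorph0 mulr0.
    by rewrite sub0r (conv_shiftr N a (H f \o v)); ring.
  rewrite E1 E2 tk /Ak (KM t c); move: tk2.
  set s' := (th * _)%:K; set s := (th * _)%:K; set T := t%:K; set C := c%:K.
  set y := a _ => tk2; apply: subr0_eq; rewrite -[RHS](mulr0 (- (C * 'X))).
  by rewrite -(subrr (T * s' * y)) {2}tk2; ring.
have AkE (j : int) : (j < k)%R -> Ak j = (Ei j)%:P.
  move=> jk; have [j0|j0] : (j < 0)%R \/ (0 <= j)%R by lia.
    by rewrite AkN // Ei_lt0 ?polyC0.
  by apply: IH; lia.
(* By induction [Ak] and [Ei] agree below degree [k], so the two convolutions differ in their first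
   term only; comparing both equations leaves [(1 - t^k) (Ak k - Ei k) = 0]. *)
have k1 : conv N.+1 Ak (polyC \o v) k 0
    = Ak k - (Ei k)%:P + conv N.+1 (polyC \o Ei) (polyC \o v) k 0.
  rewrite (conv_recl N Ak) (conv_recl N (polyC \o Ei)) /= v0 !mulr1 addrA subrK.
  congr (_ - _).
  by apply: eq_bigr => b _; rewrite AkE //; lia.
have KC e x : (e *: x)%:P = e%:K * x%:P by rewrite -polyCM mulr_algl.
move: Akrec; rewrite k1 -conv_morph /= (recr kr); last by lia.
rewrite polyCB (KC _ (Ei k)) (KC _ (Ei (k - 2))) (AkE (k - 2)); last by lia.
have kS : `|k|%N = `|k|%N.-1.+1 by lia.
rewrite kS; set T := (t ^+ _)%:K; move: (_ * (Ei (k - 2))%:P) => z E1.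
have {E1} E2 : (1 - T) * (Ak k - (Ei k)%:P) = 0.
  rewrite -(subrr (T * Ak k - z)) -{1}E1; ring.
have TU : (1 - t ^+ `|k|%N.-1.+1)^-1%:K * (1 - T) = 1.
  by rewrite /T -K1 -KB -KM mulVr ?tU.
by apply: subr0_eq; rewrite -[LHS]mul1r -TU -mulrA E2 mulr0.
Qed.

Lemma H_Ei_coef c a (k : int) : (k <= r)%R ->
  (H (gc c) (Ei k))`_a = (- c) ^+ a *: Ei (k - a%:Z).
Proof.
elim: a k => [|a IH] k kr; have := H_Ei c kr.
  by move/polyP/(_ 0%N); rewrite coefD coefC -mulrA coefCM coefXM mulr0 addr0 /= scale1r subr0.
move/polyP/(_ a.+1); rewrite coefD coefC -mulrA coefCM coefXM /= IH; last by lia.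
rewrite mulr_algl scalerA => /eqP; rewrite addr_eq0 => /eqP ->.
by rewrite exprS mulNr scaleNr; congr (- (_ *: Ei _)); lia.
Qed.

Lemma TTc_Ei a b (k : int) : (k <= r)%R ->
  TTc a b (Ei k) = ((- th) ^+ a * (-1) ^+ b) *: Ei (k - a%:Z - b%:Z).
Proof.
move=> kr; rewrite /TTc H_Ei_coef // HZ coefZ mulr_algl H_Ei_coef; last by lia.
by rewrite scalerA mulrC; congr (_ *: Ei _); lia.
Qed.

(** Here [T(z) E(y) = E(y) / ((1 + th y z) (1 + y/z))]; the first denominator is expanded in the sum
    over [a], the second one inside [conv]. *)
Lemma B_Ei_mul (k m : int) x N : (k <= r)%R -> (k < N%:Z)%R ->
  B m (Ei k * x) = \sum_(a < N) (- th) ^+ a *: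
    conv N Ei (fun j => B j x) (k - a%:Z) (m - a%:Z).
Proof.
move=> kr kN; rewrite (@B_mul N) => [|a b Na|a b Nb].
- apply: eq_bigr => a _; rewrite /conv scaler_sumr; apply: eq_bigr => b _.
  rewrite TTc_Ei // -scalerAl -scalerA; congr (_ *: _).
  exact: signZ.
- by rewrite TTc_Ei // Ei_lt0 ?scaler0 //; lia.
- by rewrite TTc_Ei // Ei_lt0 ?scaler0 //; lia.
Qed.

Lemma conv_Ei (w : int -> A) (k m : int) N : (k < N%:Z)%R ->
  conv N.+1 Ei w k m = conv N Ei w k m.
Proof. by move=> kN; rewrite convS // => j; apply: Ei_lt0. Qed.

Lemma B_Ei_recl (k m : int) x N : (k <= r)%R -> (k < N%:Z)%R ->
  B m (Ei k * x) = conv N Ei (fun j => B j x) k m - th *: B (m - 1) (Ei (k - 1) * x).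
Proof.
move=> kr kN; rewrite (@B_Ei_mul k m x N.+1) //; last by lia.
rewrite (@B_Ei_mul (k - 1) _ x N) //; try lia.
rewrite big_ord_recl expr0 scale1r !subr0 conv_Ei //; congr (_ + _).
rewrite scaler_sumr -sumrN; apply: eq_bigr => a _.
rewrite lift0 exprS mulNr scaleNr scalerA conv_Ei; last by lia.
by congr (- (_ *: conv _ _ _ _ _)); lia.
Qed.

(** [B_Ei_recl] clears the denominator [1 + th y z] and [conv_recl] the denominator [1 + y/z]. *)
Lemma Ei_B_mul (k m : int) x : (k <= r)%R ->
  Ei k * B m x = B m (Ei k * x) + B (m + 1) (Ei (k - 1) * x)
    + th *: B (m - 1) (Ei (k - 1) * x) + th *: B m (Ei (k - 2) * x).
Proof.
move=> kr; have kN : (k < `|k|.+1%N%:Z)%R by lia.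
rewrite (B_Ei_recl m x (N := `|k|.+2) kr) //; last by lia.
rewrite (@B_Ei_recl (k - 1) (m + 1) x `|k|.+1); try lia.
rewrite conv_recl.
have -> : m + 1 - 1 = m by lia.
have -> : k - 1 - 1 = k - 2 by lia.
by move: (th *: B _ _) (th *: B m _) (conv _ _ _ _ _) => y z w; ring.
Qed.
End RecurrenceUpTo.

(** The first [n] terms contain a [v] of negative index; the rest is a shifted convolution at 0. *)
Lemma conv_Ei_neg (k : int) n N : (k < N%:Z)%R ->
  EV N k (- n%:Z) = (-1) ^+ n * EV N (k - n%:Z) 0.
Proof.
elim: n k N => [|n IH] k N kN; first by rewrite mul1r !subr0.
rewrite -conv_Ei // conv_recl v_lt0 ?mulr0 ?sub0r; last by lia.
have -> : - n.+1%:Z + 1 = - n%:Z by lia.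
rewrite IH; last by lia.
rewrite exprS mulN1r mulNr; congr (- (_ * conv _ _ _ _ _)); lia.
Qed.

(** The recurrence up to degree [n] determines [B m (Ei k)] for [k <= n]; its value at [m = 1],
    [k = n] must agree with [B1_E], which is the recurrence in degree [n + 1]. *)
Lemma E_recurrence_all k : E_recurrence k.
Proof.
suff {k} recn n : forall k : int, (k <= n%:Z)%R -> E_recurrence k by apply: (recn `|k|%N); lia.
elim: n => [|n IH] k kn.
  have [/E_recurrence_lt0//|k0] : (k < 0)%R \/ k = 0 by lia.
  move=> [|N] kN; first by lia.
  rewrite k0 conv_recl /= E0 v0 mulr1 expr0 scale1r scaler0 !subr0.
  rewrite /conv big1 ?subr0 // => b _; rewrite Ei_lt0 ?mul0r ?mulr0 //; lia.
have [kn'|->{k kn}] : (k <= n%:Z)%R \/ k = n.+1%:Z by lia.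
  exact: IH.
have CX (k m : int) N : (k <= n%:Z)%R -> (k < N%:Z)%R ->
    B m (Ei k) = EV N k m - th *: B (m - 1) (Ei (k - 1)).
  move=> kn kN; have := B_Ei_recl IH m 1 kn kN; rewrite !mulr1 => ->.
  by congr (_ - _); apply: eq_bigr => b _; rewrite B1.
(* [CX] replaces the pair [(k, -i)] by [(k - 1, -(i + 1))], so the induction runs over an upper
   bound [j] of [k + 1] with [i] free. The two terms with [th] cancel. *)
have Cneg j : forall k : int, (k <= n%:Z)%R -> (k <= j%:Z - 1)%R -> forall i,
    B (- i%:Z) (Ei k) = ((-1) ^+ i * t ^+ `|(k - i%:Z)%R|) *: Ei (k - i%:Z).
  elim: j => [|j IHj] k kn kj i.
    by rewrite !Ei_lt0 ?B0 ?scaler0 //; lia.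
  rewrite (CX k _ `|k|.+1) //; last by lia.
  rewrite conv_Ei_neg; last by lia.
  rewrite IH; try lia.
  have -> : - i%:Z - 1 = - i.+1%:Z by lia.
  rewrite IHj; try lia.
  have -> : k - 1 - i.+1%:Z = k - i%:Z - 2 by lia.
  rewrite -signZ scalerBr !scalerA -addrA -opprD -scalerDl.
  rewrite [X in _ - X *: _](_ : _ = 0) ?scale0r ?subr0 // exprS; ring.
move=> N nN.
(* [B 1 (E n)] computed in two ways; the correction term [B 0 (Ei (n - 1))] is supplied by [Cneg]
   with [i = 0]. *)
have E1 := CX n%:Z 1 N ltac:(lia) ltac:(lia).
have E2 := Cneg n (n%:Z - 1) ltac:(lia) ltac:(lia) 0%N.
have {}E2 : B (1 - 1) (Ei (n%:Z - 1)) = t ^+ `|(n.+1%:Z - 2)%R| *: Ei (n.+1%:Z - 2).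
  by rewrite E2 expr0 mul1r; congr (_ ^+ _ *: Ei _); lia.
move: E1; rewrite B1_E E2 scalerA => /eqP; rewrite eq_sym subr_eq => /eqP E3.
rewrite -conv_Ei // conv_recl v0 mulr1 add0r.
have -> : n.+1%:Z - 1 = n%:Z by lia.
by rewrite E3 /= scalerBl scale1r opprD opprB addrA addrCA subrr addr0.
Qed.

Lemma Ei_B (k m : int) x :
  Ei k * B m x = B m (Ei k * x) + B (m + 1) (Ei (k - 1) * x)
    + th *: B (m - 1) (Ei (k - 1) * x) + th *: B m (Ei (k - 2) * x).
Proof. by apply: (@Ei_B_mul k) => // j _; apply: E_recurrence_all. Qed.

Lemma iterB1 n : iter n (B 1) 1 = ph n *: E n.
Proof. by rewrite /E scalerA divrr ?scale1r ?phU. Qed.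

(** * t-binomials and powers of a vertex operator *)

Definition qb (k j : nat) : K :=
  if (j <= k)%N then ph k / (ph j * ph (k - j)) else 0.

Lemma qb0 k : qb k 0 = 1.
Proof. by rewrite /qb leq0n ph0 mul1r subn0 divrr ?phU. Qed.

Lemma qbnn k : qb k k = 1.
Proof. by rewrite /qb leqnn subnn ph0 mulr1 divrr ?phU. Qed.

Lemma qb_small k j : (k < j)%N -> qb k j = 0.
Proof. by rewrite /qb ltnNge => /negbTE ->. Qed.

Lemma qbM k j : (j <= k)%N -> qb k j * (ph j * ph (k - j)) = ph k.
Proof. by move=> jk; rewrite /qb jk divrK // unitrM !phU. Qed.

(** Both Pascal rules as a pair: [D] uses the first one, [U] the second. With denominators cleared,
    each is a way of writing [1 - t^(i+j+2)] as a combination of [1 - t^(i+1)] and [1 - t^(j+1)]. *)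
Lemma qb_pascal k j :
  (qb k.+1 j.+1 = qb k j.+1 + t ^+ (k - j) * qb k j) *
  (qb k.+1 j.+1 = t ^+ j.+1 * qb k j.+1 + qb k j).
Proof.
have [kj|jk] := ltnP k j; first by rewrite !qb_small ?mulr0 ?addr0 //; lia.
have [->|kj] := eqVneq k j.
  by rewrite !qbnn qb_small // subnn expr0 mulr0 mulr1 !add0r.
have [i ->] : exists i, k = (i + j).+1 by exists (k - j).-1; lia.
have U1 : ph j.+1 * ph i.+1 \is a GRing.unit by rewrite unitrM !phU.
have E1 : qb (i + j).+2 j.+1 * (ph j.+1 * ph i.+1) = ph (i + j).+2.
  by rewrite -[RHS](@qbM _ j.+1); [congr (_ * (_ * ph _))|]; lia.
have E2 : qb (i + j).+1 j.+1 * (ph j.+1 * ph i) = ph (i + j).+1.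
  by rewrite -[RHS](@qbM _ j.+1); [congr (_ * (_ * ph _))|]; lia.
have E3 : qb (i + j).+1 j * (ph j * ph i.+1) = ph (i + j).+1.
  by rewrite -[RHS](@qbM _ j); [congr (_ * (_ * ph _))|]; lia.
have -> : ((i + j).+1 - j = i.+1)%N by lia.
have key c c' : c * (1 - t ^+ i.+1) + c' * (1 - t ^+ j.+1) = 1 - t ^+ (i + j).+2 ->
    qb (i + j).+2 j.+1 = c * qb (i + j).+1 j.+1 + c' * qb (i + j).+1 j.
  move=> cc; apply: (mulIr U1); rewrite E1 phS -cc mulrDr.
  rewrite -{1}E2 -E3 (phS i) (phS j); ring.
have ex : t ^+ (i + j).+2 = t ^+ i.+1 * t ^+ j.+1 by rewrite -exprD; congr (_ ^+ _); lia.
split; first by rewrite -[X in _ = X + _]mul1r; apply: key; rewrite ex; ring.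
by rewrite -[X in _ = _ + X]mul1r; apply: key; rewrite ex; ring.
Qed.

Lemma iter_BZ m n c x : iter n (B m) (c *: x) = c *: iter n (B m) x.
Proof. by elim: n => //= n ->; rewrite BZ. Qed.

Lemma iter_BD m n : {morph iter n (B m) : x y / x + y}.
Proof. by move=> x y; elim: n => //= n ->; rewrite BD. Qed.

Lemma iter_B0 m n : iter n (B m) 0 = 0.
Proof. by elim: n => //= n ->; rewrite B0. Qed.

Lemma iter_B_sum m n I (r : seq I) P (p : I -> A) :
  iter n (B m) (\sum_(i <- r | P i) p i) = \sum_(i <- r | P i) iter n (B m) (p i).
Proof. exact: (big_morph _ (iter_BD m n) (iter_B0 m n)). Qed.

Lemma B_iter_straighten m n x :
  B m (iter n (B (m + 1)) x) = t ^+ n *: iter n (B (m + 1)) (B m x).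
Proof.
elim: n => [|n IH] /=; first by rewrite scale1r.
by rewrite BB_straighten IH BZ scalerA -exprS.
Qed.

(** Each of the [n] factors is kept or lowered to [m - 1]. Straightening moves the lowered ones to
    the right, and the powers of [t] add up to a t-binomial. *)
Lemma Di_iterB n (k m : int) x : Di k (iter n (B m) x) =
  \sum_(j < n.+1) qb n j *:
     iter (n - j) (B m) (iter j (B (m - 1)) (Di (k - j%:Z) x)).
Proof.
elim: n k => [|n IH] k; first by rewrite big_ord1 qb0 scale1r subr0.
pose F j := iter (n.+1 - j) (B m) (iter j (B (m - 1)) (Di (k - j%:Z) x)).
transitivity (\sum_(j < n.+1) (qb n j *: F j + (t ^+ (n - j) * qb n j) *: F j.+1)).
  rewrite Di_B !IH !B_sum -big_split; apply: eq_bigr => j _ /=.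
  rewrite !BZ mulrC -scalerA; congr (_ *: _ + _ *: _).
    by rewrite /F subSn ?leq_ord.
  have := B_iter_straighten (m - 1) (n - j) (iter j (B (m - 1)) (Di (k - 1 - j%:Z) x)).
  rewrite subrK => ->; rewrite /F subSS /=.
  by congr (_ *: iter _ _ (B _ (iter _ _ (Di _ _)))); lia.
rewrite big_split /= big_ord_recl [in RHS]big_ord_recl !qb0 -addrA; congr (_ + _).
rewrite [in RHS]big_ord_recr /= -[X in _ = _ + X]/(_ *: F n.+1) qbnn.
rewrite [X in _ + X]big_ord_recr /= subnn expr0 mul1r qbnn addrA; congr (_ + _).
rewrite -big_split; apply: eq_bigr => j _ /=.
by rewrite -scalerDl (qb_pascal _ _).1.
Qed.

(** * The strip-adding operator U *)

Fixpoint Ufix (n b : nat) (x : A) : A :=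
  if n is n'.+1 then
    E b * x - \sum_(a < b) th ^+ a.+1 *: Ufix n' (b - a.+1) (D a.+1 x)
  else 0.
(* [U] is the part of multiplication by [E] that remains after [D] is split
   off: [E(y) = U(y) D(theta y)]. *)
Definition U (b : nat) : A -> A := Ufix b.+1 b.
Notation Ui := (ext U).

(** [Ufix] calls itself at [b - a.+1], which is no structural descent, hence the fuel; every amount
    above [b] gives the same value. *)
Lemma Ufix_fuel n m b x : (b < n)%N -> (b < m)%N -> Ufix n b x = Ufix m b x.
Proof.
elim: n m b x => [|n IH] [|m] b x //= bn bm.
congr (_ - _); apply: eq_bigr => a _; congr (_ *: _); have := ltn_ord a; move=> ab; apply: IH; lia.
Qed.

Lemma U_rec b x :
  U b x = E b * x - \sum_(a < b) th ^+ a.+1 *: U (b - a.+1) (D a.+1 x).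
Proof.
rewrite {1}/U /=; congr (_ - _); apply: eq_bigr => a _; congr (_ *: _).
by apply: Ufix_fuel; have := ltn_ord a; lia.
Qed.

Lemma E_U b x : E b * x = \sum_(a < b.+1) th ^+ a *: U (b - a) (D a x).
Proof. by rewrite big_ord_recl expr0 scale1r subn0 D_0 U_rec subrK. Qed.

Lemma U0 b : U b 0 = 0.
Proof.
have [n] := ubnP b; elim: n b => // n IH b bn.
rewrite U_rec mulr0 big1 ?subr0 // => a _; rewrite D0x IH ?scaler0 //.
by have := ltn_ord a; lia.
Qed.

Lemma UD b : {morph U b : x y / x + y}.
Proof.
have [n] := ubnP b; elim: n b => // n IH b bn x y.
rewrite !U_rec mulrDr addrACA -opprD -big_split; congr (_ - _).
apply: eq_bigr => a _; rewrite DD IH ?scalerDr //.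
by have := ltn_ord a; lia.
Qed.

Lemma UZ b c x : U b (c *: x) = c *: U b x.
Proof.
have [n] := ubnP b; elim: n b x => // n IH b x bn.
rewrite !U_rec -scalerAr scalerBr scaler_sumr; congr (_ - _).
apply: eq_bigr => a _; rewrite DZ IH ?scalerA 1?mulrC //.
by have := ltn_ord a; lia.
Qed.

Lemma U_one b : U b 1 = E b.
Proof.
rewrite -[RHS]mulr1 E_U big_ord_recl expr0 scale1r subn0 D_0 big1 ?addr0 // => a _.
by rewrite lift0 D_one U0 scaler0.
Qed.

Lemma Ei_U (k : int) N x : (k < N%:Z)%R ->
  Ei k * x = \sum_(a < N) th ^+ a *: Ui (k - a%:Z) (D a x).
Proof.
case: k => k kN; last first.
  by rewrite mul0r big1 // => a _; rewrite ext_lt0 ?scaler0 //; lia.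
rewrite /= E_U -(big_mkord xpredT (fun a => th ^+ a *: U (k - a) (D a x))).
rewrite -(big_mkord xpredT (fun a => th ^+ a *: Ui (k%:Z - a%:Z) (D a x))).
rewrite [RHS](@big_cat_nat _ _ _ k.+1) //= [X in _ + X]big_nat_cond [X in _ + X]big1 ?addr0.
  apply: eq_big_nat => a ak; congr (_ *: _).
  by have -> : k%:Z - a%:Z = (k - a)%N by lia.
by move=> a /andP[/andP[ka _] _]; rewrite ext_lt0 ?scaler0 //; lia.
Qed.

(* Induction on the degree of [U] through the triangular relation [Ei_U]. *)
Lemma Ui_ind (I : Type) (Q : I -> int -> A -> A) :
  (forall i (k : int) x, (k < 0)%R -> Q i k x = 0) ->
  (forall i (k : int) N x, (k < N.+1%:Z)%R ->
     (forall i (j : int) y, (j < k)%R -> Q i j y = 0) ->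
     \sum_(a < N.+1) th ^+ a *: Q i (k - a%:Z) (D a x) = 0) ->
  forall i k x, Q i k x = 0.
Proof.
move=> Qlt Qsum i k x.
have [n] := ubnP `|k|%N; elim: n i k x => // n IH i k x kn.
have [/Qlt//|k0] : (k < 0)%R \/ (0 <= k)%R by lia.
have Q0 i' (j : int) y : (j < k)%R -> Q i' j y = 0.
  move=> jk; have [/Qlt//|j0] : (j < 0)%R \/ (0 <= j)%R by lia.
  by apply: IH; lia.
have := @Qsum i k `|k|%N x ltac:(lia) Q0.
rewrite big_ord_recl expr0 scale1r subr0 D_0 big1 ?addr0 // => a _.
by rewrite Q0 ?scaler0 // lift0; lia.
Qed.

Lemma Ui0 k : Ui k 0 = 0.
Proof. by case: k => k //=; rewrite U0. Qed.

Lemma UiD k : {morph Ui k : x y / x + y}.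
Proof. by case: k => k x y /=; rewrite ?UD ?addr0. Qed.

Lemma Di0 k : Di k 0 = 0.
Proof. by case: k => k //=; rewrite D0x. Qed.

(** [E(y)] passes [B(z)] with the factor [(1 + y/z) (1 + th y z)] and [D(th y)] with the factor
    [1 + th y z], so [1 + y/z] is left for [U(y)]. *)
Lemma Ui_B (k m : int) x : Ui k (B m x) = B m (Ui k x) + B (m + 1) (Ui (k - 1) x).
Proof.
apply: subr0_eq; move: m k x.
pose Q m (k : int) x := Ui k (B m x) - (B m (Ui k x) + B (m + 1) (Ui (k - 1) x)).
apply: (@Ui_ind _ Q) => [m k x k0|m k N x kN Q0].
  by rewrite /Q !ext_lt0 ?B0 ?addr0 ?subrr //; lia.
have SB (c e : int) : (0 <= e)%R ->
    \sum_(a < N.+1) th ^+ a *: B c (Ui (k - a%:Z - e) (D a x)) = B c (Ei (k - e) * x).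
  move=> e0; rewrite (@Ei_U (k - e) N.+1) ?B_sum; last by lia.
  by apply: eq_bigr => a _; rewrite BZ; congr (_ *: B _ (Ui _ _)); lia.
(* Commuting [D] with [B] creates terms with [B (m - 1)] under a [U] of lower degree. The induction
   hypothesis is applied to them, which is why [Q] has the index [m]. *)
have S1 : \sum_(a < N.+1) th ^+ a *: Ui (k - a%:Z) (B m (D a x))
  = Ei k * B m x - th *: B (m - 1) (Ei (k - 1) * x) - th *: B m (Ei (k - 2) * x).
  rewrite (Ei_U _ kN); apply/eqP; rewrite eq_sym -addrA -opprD subr_eq; apply/eqP.
  under eq_bigr do rewrite D_B UiD scalerDr.
  rewrite big_split /=; congr (_ + _).
  rewrite big_ord_recl [Di _ _]ext_lt0 // B0 Ui0 scaler0 add0r.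
  rewrite (@Ei_U (k - 1) N) ?(@Ei_U (k - 2) N); try lia.
  rewrite !B_sum !scaler_sumr -big_split; apply: eq_bigr => a _; rewrite lift0.
  have -> : a.+1%:Z - 1 = a%:Z by lia.
  rewrite /= !BZ !scalerA -exprS -scalerDr; congr (_ *: _).
  have := Q0 (m - 1) (k - a.+1%:Z) (D a x); rewrite /Q => /(_ ltac:(lia))/subr0_eq ->.
  by congr (B _ (Ui _ _) + B _ (Ui _ _)); lia.
under eq_bigr do rewrite /Q -[X in B m (Ui X _)]subr0 scalerBr scalerDr.
rewrite sumrB big_split S1 /= !SB // subr0 Ei_B; move: (B _ _) (B _ _) => y z.
by move: (th *: _) (th *: _) => y' z'; ring.
Qed.

(** The counterpart of [Di_iterB]: the raised factors are moved to the left, which calls for the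
    other Pascal rule. *)
Lemma Ui_iterB n (k m : int) x : Ui k (iter n (B m) x) =
  \sum_(j < n.+1) qb n j *:
     iter j (B (m + 1)) (iter (n - j) (B m) (Ui (k - j%:Z) x)).
Proof.
elim: n k => [|n IH] k; first by rewrite big_ord1 qb0 scale1r subr0.
pose F j := iter j (B (m + 1)) (iter (n.+1 - j) (B m) (Ui (k - j%:Z) x)).
transitivity (\sum_(j < n.+1) ((t ^+ j * qb n j) *: F j + qb n j *: F j.+1)).
  rewrite /= Ui_B !IH !B_sum -big_split; apply: eq_bigr => j _ /=.
  rewrite !BZ mulrC -scalerA; congr (_ *: _ + _ *: _).
    by rewrite B_iter_straighten /F subSn ?leq_ord.
  rewrite /F subSS /=.
  by congr (B _ (iter _ _ (iter _ _ (Ui _ _)))); lia.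
rewrite big_split /= big_ord_recl [in RHS]big_ord_recl !qb0 expr0 mul1r -addrA.
congr (_ + _).
rewrite [in RHS]big_ord_recr /= -[X in _ = _ + X]/(_ *: F n.+1) qbnn.
rewrite [X in _ + X]big_ord_recr /= qbnn addrA; congr (_ + _).
rewrite -big_split; apply: eq_bigr => j _ /=.
by rewrite -scalerDl (qb_pascal _ _).2.
Qed.

(** * Exchanging D and U *)

Lemma D_mul a x y : D a (x * y) = \sum_(i < a.+1) D i x * D (a - i) y.
Proof. by rewrite /D rmorphM coefM. Qed.

Lemma Di_mul a N x y : (a < N)%N ->
  D a (x * y) = \sum_(i < N) D i x * Di (a%:Z - i%:Z) y.
Proof.
move=> aN; rewrite D_mul -(big_mkord xpredT (fun i => D i x * D (a - i) y)).
rewrite -(big_mkord xpredT (fun i => D i x * Di (a%:Z - i%:Z) y)).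
rewrite [RHS](@big_cat_nat _ _ _ a.+1) //= [X in _ + X]big_nat_cond [X in _ + X]big1 ?addr0.
  apply: eq_big_nat => i ia; congr (_ * _).
  by have -> : a%:Z - i%:Z = (a - i)%N by lia.
by move=> i /andP[/andP[ia _] _]; rewrite ext_lt0 ?mulr0 //; lia.
Qed.

Lemma Di_one k : Di k 1 = (k == 0)%:R.
Proof. by case: k => k //=; rewrite D_one. Qed.

Lemma B0_one n : iter n (B 0) 1 = 1.
Proof. by elim: n => //= n ->; rewrite B1. Qed.

(** Expand [D] over [B_1^k 1]: since [D i 1 = 0] for [i > 0], only the term with [a] lowered factors
    survives, and [B_0^a 1 = 1]. This is the origin of the scalar series with coefficients
    [1 / ph n]. *)
Lemma D_Ei a k : D a (Ei k) = (ph a)^-1 *: Ei (k - a%:Z).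
Proof.
case: k => b; last by rewrite D0x Ei_lt0 ?scaler0 //; lia.
rewrite /= /E DZ -[D a _]/(Di a%:Z _) Di_iterB.
have [ab|ba] := leqP a b.
  rewrite (bigD1 (Ordinal (ab : a < b.+1)%N)) //= big1 ?addr0 => [|i ia].
    rewrite !subrr Di_one eqxx (_ : b%:Z - a%:Z = (b - a)%N) /=; last by lia.
    rewrite B0_one iterB1 /qb ab !scalerA; congr (_ *: _).
    rewrite mulrA mulKr ?phU // invrM ?phU //; congr (_ * _).
    by rewrite mulrAC mulVr ?phU // mul1r.
  rewrite Di_one (_ : _ == _ = false) ?mulr0n ?iter_B0 ?scaler0 //.
  by move: ia; rewrite -val_eqE /=; lia.
rewrite Ei_lt0 ?scaler0; last by lia.
rewrite big1 ?scaler0 // => i _; rewrite Di_one (_ : _ == _ = false) ?iter_B0 ?scaler0 //.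
by have := ltn_ord i; lia.
Qed.

(** As [D(u)] is multiplicative, it passes [E(y)] at the cost of the scalar series of [D_Ei]; the
    operators [D] commute among themselves, so the whole cost falls on [U]. *)
Lemma D_Ui (a : nat) (k : int) N x : (a < N)%N -> D a (Ui k x)
  = \sum_(i < N) (ph i)^-1 *: Ui (k - i%:Z) (Di (a%:Z - i%:Z) x).
Proof.
(* [tt] is a dummy value for the index that [Ui_ind] expects. *)
move=> aN; apply: subr0_eq; move: (tt) k x.
pose Q (_ : unit) k x := D a (Ui k x)
   - \sum_(i < N) (ph i)^-1 *: Ui (k - i%:Z) (Di (a%:Z - i%:Z) x).
apply: (@Ui_ind _ Q) => [u k x k0|u k M x kM _].
  rewrite /Q ext_lt0 // D0x sub0r big1 ?oppr0 // => i _.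
  by rewrite ext_lt0 ?scaler0 //; lia.
transitivity (\sum_(c < M.+1) (D a (th ^+ c *: Ui (k - c%:Z) (D c x)) - th ^+ c *:
    \sum_(i < N) (ph i)^-1 *: Ui (k - c%:Z - i%:Z) (Di (a%:Z - i%:Z) (D c x)))).
  by apply: eq_bigr => c _; rewrite /Q scalerBr DZ.
rewrite sumrB -D_sum -(Ei_U _ kM) (Di_mul _ _ aN); apply/eqP; rewrite subr_eq0; apply/eqP.
rewrite [RHS](eq_bigr _ (fun c _ => scaler_sumr _ _ _ _)).
rewrite exchange_big; apply: eq_bigr => i _ /=.
rewrite D_Ei -scalerAl (@Ei_U _ M.+1); last by lia.
rewrite scaler_sumr; apply: eq_bigr => c _; rewrite !scalerA mulrC; congr (_ *: _).
have -> : D c (Di (a%:Z - i%:Z) x) = Di (a%:Z - i%:Z) (D c x).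
  by case: (_ - _) => j /=; rewrite ?D0x // D_D.
by congr (Ui _ _); lia.
Qed.

(** The two scalar series are inverse to each other. After multiplication by [ph n] the second
    Pascal rule makes the sum telescope. *)
Lemma qb_alternating n :
  \sum_(i < n.+1) (-1) ^+ i * t ^+ 'C(i, 2) / (ph i * ph (n - i)) = (n == 0%N)%:R.
Proof.
case: n => [|n]; first by rewrite big_ord1 subn0 ph0 bin_small // !expr0 !mul1r invr1.
pose g i := (-1) ^+ i * t ^+ 'C(i.+1, 2) * qb n i.
pose s := \sum_(i < n.+2) (-1) ^+ i * t ^+ 'C(i, 2) * qb n.+1 i.
suff S : s = 0.
  transitivity ((ph n.+1)^-1 * s); last by rewrite S mulr0.
  rewrite mulr_sumr; apply: eq_bigr => i _.
  rewrite /qb leq_ord [RHS]mulrCA; congr (_ * _).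
  by rewrite mulKr ?phU.
rewrite /s big_ord_recl qb0 bin_small // !expr0 !mul1r.
rewrite (eq_bigr (fun i : 'I_n.+1 => g i.+1 - g i)) => [|i _]; last first.
  rewrite lift0 /g (qb_pascal _ _).2 (binS i.+1 1) bin1 exprD [(-1) ^+ i.+1]exprS.
  by rewrite !exprS; ring.
rewrite -(big_mkord xpredT (fun i => g i.+1 - g i)) telescope_sumr //.
by rewrite /g qb_small // qb0 mulr0 sub0r bin_small // !mulr1 subrr.
Qed.

Lemma sum_antidiagonal (c : nat -> nat -> K) (P : nat -> A) N :
  (forall n, (N <= n)%N -> P n = 0) ->
  \sum_(i < N) \sum_(j < N) c i j *: P (i + j)%N
   = \sum_(n < N) (\sum_(i < n.+1) c i (n - i)%N) *: P n.
Proof.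
move=> P0; transitivity (\sum_(0 <= i < N) \sum_(0 <= n < N | (i <= n)%N) c i (n - i)%N *: P n).
  rewrite big_mkord; apply: eq_bigr => i _.
  rewrite -(big_mkord xpredT (fun j => c i j *: P (i + j)%N)).
  rewrite (@big_cat_nat _ _ _ (N - i)) ?leq_subr //= [X in _ + X]big_nat_cond.
  rewrite [X in _ + X]big1 ?addr0; last first.
    by move=> j /andP[/andP[ij _] _]; rewrite P0 ?scaler0 //; lia.
  rewrite -(big_nat_widenl i 0 N (fun _ => true)) //.
  have := big_addn 0 N i xpredT (fun n => c i (n - i)%N *: P n).
  rewrite add0n => ->; apply: eq_bigr => j _.
  by rewrite addnK addnC.
rewrite (exchange_big_dep_nat xpredT) //= big_mkord; apply: eq_bigr => n _.
rewrite scaler_suml -(big_mkord xpredT (fun i => c i (n - i)%N *: P n)).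
by rewrite [RHS](big_nat_widen _ _ N) ?ltn_ord //; apply: eq_bigl => i; rewrite ltnS.
Qed.

(** Insert [D_Ui] and collect the terms by [n = i + j]: [qb_alternating] leaves [n = 0] alone. *)
Lemma D_U_inversion a b N x : (a < N)%N ->
  \sum_(i < N) ((-1) ^+ i * t ^+ 'C(i, 2) / ph i) *:
     Di (a%:Z - i%:Z) (Ui (b%:Z - i%:Z) x) = U b (D a x).
Proof.
move=> aN; pose P n := Ui (b%:Z - n%:Z) (Di (a%:Z - n%:Z) x).
pose c i j := (-1) ^+ i * t ^+ 'C(i, 2) / (ph i * ph j).
transitivity (\sum_(i < N) \sum_(j < N) c i j *: P (i + j)%N).
  apply: eq_bigr => i _.
  have -> : Di (a%:Z - i%:Z) (Ui (b%:Z - i%:Z) x)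
      = \sum_(j < N) (ph j)^-1 *: P (i + j)%N.
    have [ai|ia] := leqP i a.
      rewrite (_ : a%:Z - i%:Z = (a - i)%N) /= ?(@D_Ui _ _ N); try lia.
      by apply: eq_bigr => j _; congr (_ *: ext U _ (ext D _ _)); lia.
    rewrite ext_lt0 ?big1 //; last by lia.
    by move=> j _; rewrite /P [Di _ _]ext_lt0 ?Ui0 ?scaler0 //; lia.
  rewrite scaler_sumr; apply: eq_bigr => j _; rewrite scalerA; congr (_ *: _).
  by rewrite /c invrM ?phU // -!mulrA [(ph i)^-1 * _]mulrC.
rewrite sum_antidiagonal => [|n Nn]; last first.
  by rewrite /P [Di _ _]ext_lt0 ?Ui0 //; lia.
case: N aN => // N aN; rewrite big_ord_recl qb_alternating scale1r big1 ?addr0.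
  by rewrite /P !subr0.
by move=> n _; rewrite lift0 qb_alternating scale0r.
Qed.

(** * Action of D and U on the functions of partitions *)

Fixpoint Wm (ms : seq nat) : A :=
  if ms is m :: ms' then iter m (B (size ms').+1%:Z) (Wm ms') else 1.

Fixpoint qbs (ms js : seq nat) : K :=
  if (ms, js) is (m :: ms', j :: js') then qb m j * qbs ms' js' else 1.

(** The [c] extra operators are the parts just lowered from the block above. They have the index of
    the current block and merge with it, so the induction closes only with [c] in the statement. *)
Lemma Di_Wm k c ms : iter c (B (size ms)%:Z) (Di k (Wm ms)) =
  \sum_(js <- choices ms | (sumn js)%:Z == k) qbs ms js *: Wm (lower c ms js).
Proof.
elim: ms k c => [|m ms IH] k c.
  (* Parts lowered to 0 disappear because [B 0 1 = 1]. *)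
  rewrite big_mkcond big_seq1 /= Di_one scale1r [k == 0]eq_sym.
  by case: eqP => _; rewrite ?iter_B0 // B0_one.
rewrite big_mkcond big_choices Di_iterB iter_B_sum; apply: eq_bigr => j _.
rewrite -big_mkcond iter_BZ -iterD.
have -> : (size ms).+1%:Z - 1 = (size ms)%:Z by lia.
rewrite IH iter_B_sum scaler_sumr big_seq_cond [RHS]big_seq_cond.
apply: eq_big => js; first by congr (_ && _); rewrite /=; lia.
case/andP=> jsms _; rewrite iter_BZ scalerA /= size_lower // addnC; congr (_ *: iter _ (B _) _).
Qed.

Lemma Wm_raise c ms js : js \in choices ms ->
  Wm (raise c ms js) = iter (head c js) (B (size ms).+1%:Z) (Wm (raise_tail c ms js)).
Proof. by move=> jsms; rewrite /= size_raise_tail. Qed.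

(** The degree [c] not spent on raising parts reaches [U c 1 = E c], which is [B_1^c 1 / ph c]:
    these are [c] new parts 1, and the division by [ph] comes from here. *)
Lemma Ui_Wm (k : int) ms : Ui k (Wm ms) =
  \sum_(js <- choices ms | ((sumn js)%:Z <= k)%R)
    (qbs ms js / ph `|(k - (sumn js)%:Z)%R|) *: Wm (raise `|(k - (sumn js)%:Z)%R| ms js).
Proof.
elim: ms k => [|m ms IH] k.
  rewrite big_mkcond big_seq1 /= subr0; case: k => k //=.
  by rewrite U_one mul1r.
rewrite big_mkcond big_choices Ui_iterB; apply: eq_bigr => j _.
rewrite -big_mkcond IH 2!iter_B_sum scaler_sumr big_seq_cond [RHS]big_seq_cond.
apply: eq_big => js; first by congr (_ && _); rewrite /=; lia.
case/andP=> jsms _; rewrite !iter_BZ scalerA.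
have -> : `|(k - j%:Z - (sumn js)%:Z)%R|%N = `|(k - (sumn ((j : nat) :: js))%:Z)%R|%N.
  by rewrite /=; congr absz; lia.
rewrite Wm_raise // -mulrA; set c := absz _.
rewrite /= size_raise_tail // mulrA -iterD; congr (_ *: iter _ (B _) _); lia.
Qed.

Definition W (la : seq nat) : A := foldr (fun m x => B m%:Z x) 1 la.

Lemma W_mpart ms : W (mpart ms) = Wm ms.
Proof.
elim: ms => //= m ms <-; rewrite /W foldr_cat.
by elim: m => //= m ->.
Qed.

Lemma W_nseq1_mul r x :
  W (nseq r 1%N) * x = \sum_(a < r.+1) (ph r * th ^+ a) *: U (r - a) (D a x).
Proof.
have -> : W (nseq r 1%N) = ph r *: E r.
  by rewrite -iterB1; elim: (r) => //= n <-.
rewrite -scalerAl E_U scaler_sumr; apply: eq_bigr => a _; exact: scalerA.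
Qed.

Lemma D_U_up_down a b x :
  \sum_(i < (minn a b).+1) ((-1) ^+ i * t ^+ 'C(i, 2) / ph i) *: D (a - i) (U (b - i) x)
  = U b (D a x).
Proof.
rewrite -(@D_U_inversion a b (maxn a b).+1 x); last by rewrite ltnS leq_maxl.
pose F i := ((-1) ^+ i * t ^+ 'C(i, 2) / ph i) *:
     Di (a%:Z - i%:Z) (Ui (b%:Z - i%:Z) x).
rewrite -(big_mkord xpredT F) (big_cat_nat (n := (minn a b).+1)) //=; last by lia.
rewrite [X in _ = _ + X]big_nat_cond [X in _ = _ + X]big1 ?addr0; last first.
  move=> i /andP[/andP[i1 _] _]; rewrite /F.
  have [ai|ai] := ltnP a i; first by rewrite ext_lt0 ?scaler0 //; lia.
  by rewrite [Ui _ _]ext_lt0 ?Di0 ?scaler0 //; lia.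
rewrite big_mkord; apply: eq_bigr => i _; rewrite /F; congr (_ *: _).
by have ? := ltn_ord i; rewrite !subzn //=; lia.
Qed.

Lemma D_W a ms : D a (W (mpart ms)) =
  \sum_(js <- choices ms | sumn js == a) qbs ms js *: W (mpart (lower 0 ms js)).
Proof.
rewrite W_mpart -[LHS]/(iter 0 (B (size ms)%:Z) (Di a%:Z (Wm ms))) Di_Wm.
by apply: eq_big => // js _; rewrite W_mpart.
Qed.

Lemma U_W b ms : U b (W (mpart ms)) =
  \sum_(js <- choices ms | (sumn js <= b)%N)
    (qbs ms js / ph (b - sumn js)) *: W (mpart (raise (b - sumn js) ms js)).
Proof.
rewrite W_mpart -[LHS]/(Ui b%:Z (Wm ms)) Ui_Wm; apply: eq_big => // js le.
by rewrite W_mpart subzn.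
Qed.

Lemma vertex_operators : exists (B : int -> A -> A) (D U : nat -> A -> A),
  let W la := foldr (fun (m : nat) x => B m%:Z x) 1 la in
  [/\ forall m, {morph B m : x y / x + y},
      forall m c x, B m (c *: x) = c *: B m x,
      forall m, B m 1 = v m &
      forall m (k : int) x N, (k < N%:Z)%R -> B m (v k * x) =
        \sum_(a < N) \sum_(b < N)
          (gc th a * gc 1 b) *: (v (k - a%:Z - b%:Z) * B (m - a%:Z + b%:Z) x)] /\
  [/\ forall a, linear (D a), forall b, linear (U b),
      forall r x, W (nseq r 1%N) * x =
        \sum_(a < r.+1) (ph r * th ^+ a) *: U (r - a)%N (D a x),
      forall a b x, \sum_(i < (minn a b).+1)
          ((-1) ^+ i * t ^+ 'C(i, 2) / ph i) *: D (a - i)%N (U (b - i)%N x)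
        = U b (D a x) &
      (forall a ms, D a (W (mpart ms)) =
        \sum_(js <- choices ms | sumn js == a) qbs ms js *: W (mpart (lower 0 ms js))) /\
      (forall b ms, U b (W (mpart ms)) =
        \sum_(js <- choices ms | (sumn js <= b)%N)
          (qbs ms js / ph (b - sumn js)) *: W (mpart (raise (b - sumn js) ms js)))].
Proof.
exists B, D, U; split; split=> //.
- exact: BD.
- exact: BZ.
- exact: B1.
- exact: B_v_mul.
- by move=> a c x y; rewrite DD DZ.
- by move=> b c x y; rewrite UD UZ.
- exact: W_nseq1_mul.
- exact: D_U_up_down.
by split; [exact: D_W|exact: U_W].
Qed.
End Vertex.

(** * The polynomial algebra on the v_r *)

Section Substitution.
Context (R : comNzRingType).
Local Notation Lam := {malg R[{cmonom nat}]}.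

Definition vz (k : int) : Lam :=
  match k with
  | Posz 0 => 1
  | Posz n.+1 => << ucm n >>
  | Negz _ => 0
  end.

Notation inK := (polyC \o GRing.in_alg Lam).

Definition genimg (f : nat -> R) (n : nat) : {poly Lam} :=
  \poly_(s < n.+2) (f s *: vz (n.+1%:Z - s%:Z)).

Definition monimg f (m : {cmonom nat}) : {poly Lam} :=
  \prod_(i <- finsupp m) genimg f i ^+ m i.

Lemma monimgE f (m : {cmonom nat}) (X : {fset nat}) : (finsupp m `<=` X)%fset ->
  monimg f m = \prod_(i <- X) genimg f i ^+ m i.
Proof.
move=> mX; rewrite /monimg; apply: (big_fset_incl _ mX) => i iX.
by rewrite -cmE_eq0 => /eqP ->.
Qed.

Lemma monimg_mmorphism f : mmorphism (monimg f).
Proof.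
split=> [x y|]; last by rewrite /monimg mdom1 big_seq_fset0.
rewrite (@monimgE f _ (finsupp x `|` finsupp y)%fset) ?mdomD //.
rewrite (@monimgE f x _ (fsubsetUl _ (finsupp y))) (@monimgE f y _ (fsubsetUr (finsupp x) _)).
by rewrite -big_split; apply: eq_bigr => i _; rewrite cmM exprD.
Qed.
HB.instance Definition _ f := isMultiplicative.Build _ _ (monimg f) (monimg_mmorphism f).

Definition subst_v (f : nat -> R) : {rmorphism Lam -> {poly Lam}} := mmap inK (monimg f).

Lemma subst_vZ f c x : subst_v f (c *: x) = c%:A *: subst_v f x.
Proof. by rewrite /subst_v /= mmapZ /= mul_polyC. Qed.

Lemma subst_v_gen f n : subst_v f << ucm n >> = genimg f n.
Proof.
rewrite /subst_v /= mmapU /= scale1r polyC1 mul1r /monimg mdomU big_seq_fset1.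
by rewrite cmUU expr1.
Qed.

Lemma coef_subst_v (f : nat -> R) k s : f 0%N = 1 -> (subst_v f (vz k))`_s = f s *: vz (k - s%:Z).
Proof.
move=> f0; case: k => [[|n]|n] /=.
- rewrite rmorph1 coef1 sub0r; case: s => [|s]; first by rewrite oppr0 f0 scale1r.
  by rewrite /vz /= scaler0.
- rewrite /vz /= subst_v_gen coef_poly; case: ltnP => // sn.
  by rewrite (_ : _ - _ = Negz (s - n.+2)) /= ?scaler0 //; lia.
- rewrite /vz rmorph0 coef0 (_ : _ - _ = Negz (n + s)) /= ?scaler0 //; lia.
Qed.

(** Induction on the degree of a monomial, splitting off one variable at a time. *)
Lemma Lam_ind (P : Lam -> Prop) : P 1 ->
  (forall x y, P x -> P y -> P (x + y)) -> (forall c x, P x -> P (c *: x)) ->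
  (forall k x, P x -> P (vz k * x)) -> forall x, P x.
Proof.
move=> P1 PD PZ PM x; rewrite [x]monalgE; apply: (big_ind P); [|exact: PD|].
  by have := PZ 0 1 P1; rewrite scale0r.
move=> m _; have -> : << x@_m *g m >> = x@_m *: << m >> :> Lam.
  by apply/malgP => k; rewrite mcoeffU mcoeffZ mcoeffU1 mulr_natr.
apply: (PZ x@_m << m >>).
have [d] := ubnP (mdeg m).
elim: d m => [|d IH] m md; first by case: (notF md).
have [->|m1] := eqVneq m mone; first exact: P1.
have /fset0Pn[i im] : finsupp m != fset0.
  by apply: contra_neq m1 => m0; apply: mdeg_eq0I; rewrite mdegE m0 big_seq_fset0.
have mE : m = mmul (ucm i) (divcm m (ucm i)).
  apply/eqP/cmP => j; rewrite cmM cmU divcmE cmU.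
  by case: eqP => [<-|_]; rewrite ?subn0 //= subnKC // lt0n cmE_neq0.
have -> : << m >> = vz i.+1%:Z * << divcm m (ucm i) >> :> Lam.
  by rewrite {1}mE /vz malgM_def fgmulUU mulr1.
by apply: PM; apply: IH; move: md; rewrite {1}mE mdegM mdegU; lia.
Qed.

End Substitution.

(** * Properties of substitutions, checked on generators *)

Section Generated.
Context (K : comUnitRingType) (A : comAlgType K) (v : int -> A).
Context (H : (nat -> K) -> {rmorphism A -> {poly A}}).
Hypothesis v_ind : forall P : A -> Prop, P 1 ->
  (forall x y, P x -> P y -> P (x + y)) -> (forall c x, P x -> P (c *: x)) ->
  (forall k x, P x -> P (v k * x)) -> forall x, P x.
Hypothesis HZ : forall f c x, H f (c *: x) = c%:A *: H f x.
Hypothesis Hv : forall f k s, f 0%N = 1 -> (H f (v k))`_s = f s *: v (k - s%:Z).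

Lemma coef_mul_v f k x a : f 0%N = 1 ->
  (H f (v k * x))`_a = \sum_(i < a.+1) f i *: (v (k - i%:Z) * (H f x)`_(a - i)).
Proof.
by move=> f0; rewrite rmorphM coefM; apply: eq_bigr => i _; rewrite Hv // scalerAl.
Qed.

Lemma coef0_H f x : f 0%N = 1 -> (H f x)`_0 = x.
Proof.
move=> f0; elim/v_ind: x => [|x y|c x|k x].
- by rewrite rmorph1 coef1.
- by rewrite rmorphD coefD => -> ->.
- by rewrite HZ coefZ mulr_algl => ->.
- by move=> E; rewrite coef_mul_v // big_ord1 subr0 f0 scale1r E.
Qed.

(** On [v k] both orders give [f a * g b] times [v (k - a - b)]; multiplicativity carries the
    symmetry to products. *)
Lemma coef_HC f g a b x : f 0%N = 1 -> g 0%N = 1 ->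
  (H f (H g x)`_b)`_a = (H g (H f x)`_a)`_b.
Proof.
move=> f0 g0; elim/v_ind: x a b => [|x y Ex Ey|c x E|k x E] a b.
- by rewrite !rmorph1 !coef1 !rmorph_nat !coefMn !coef1; case: a b => [|a] [|b].
- by rewrite !rmorphD !coefD !rmorphD !coefD Ex Ey.
- by rewrite !HZ !coefZ !mulr_algl !HZ !coefZ !mulr_algl E.
rewrite !coef_mul_v // !rmorph_sum !coef_sum.
under eq_bigr do rewrite HZ coefZ mulr_algl coef_mul_v // scaler_sumr.
rewrite exchange_big; apply: eq_bigr => i _ /=.
rewrite HZ coefZ mulr_algl coef_mul_v // scaler_sumr; apply: eq_bigr => j _.
by rewrite !scalerA mulrC E; congr (_ *: (v _ * _)); lia.
Qed.
End Generated.

(** * Expanding the raising and lowering operators *)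

Section Expansion.
Context (K : comUnitRingType) (A : comAlgType K) (v : int -> A) (g1 g2 : nat -> K).
Context (B : int -> A -> A).
Hypothesis BD : forall m, {morph B m : x y / x + y}.
Hypothesis BZ : forall m c x, B m (c *: x) = c *: B m x.
Hypothesis B1 : forall m, B m 1 = v m.
Hypothesis B_v_mul : forall m (k : int) x N, (k < N%:Z)%R ->
  B m (v k * x) = \sum_(a < N) \sum_(b < N)
    (g1 a * g2 b) *: (v (k - a%:Z - b%:Z) * B (m - a%:Z + b%:Z) x).

Lemma additive_B_sum m I (r : seq I) P (p : I -> A) :
  B m (\sum_(i <- r | P i) p i) = \sum_(i <- r | P i) B m (p i).
Proof.
have B0 : B m 0 = 0 by have := BZ m 0 0; rewrite !scale0r.
exact: (big_morph _ (BD m) B0).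
Qed.

(* The effect of [L_p^a R_p^b] on an index sequence. *)
Definition act (p : nat * nat) (a b : nat) (al : nat -> int) (k : nat) : int :=
  al k + (k == p.1)%:Z * (b%:Z - a%:Z) - (k == p.2)%:Z * (a%:Z + b%:Z).

(** The operator product over the pairs in [l], with both exponents at [p] cut off at [N p]. The
    final evaluation [f] is a parameter, so that another [opsum] or a [B] can be put in its
    place. *)
Fixpoint opsum (l : seq (nat * nat)) (N : nat * nat -> nat)
    (f : (nat -> int) -> A) (al : nat -> int) : A :=
  if l is p :: l' then
    \sum_(a < N p) \sum_(b < N p) (g1 a * g2 b) *: opsum l' N f (act p a b al)
  else f al.

Definition vprod n (al : nat -> int) : A := \prod_(k < n) v (al k).

Lemma opsum_cat l l' N f al : opsum (l ++ l') N f al = opsum l N (opsum l' N f) al.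
Proof.
elim: l al => //= p l IH al.
by apply: eq_bigr => a _; apply: eq_bigr => b _; rewrite IH.
Qed.

Lemma opsum_B l N m f al : B m (opsum l N f al) = opsum l N (B m \o f) al.
Proof.
elim: l al => //= p l IH al.
rewrite additive_B_sum; apply: eq_bigr => a _; rewrite additive_B_sum; apply: eq_bigr => b _.
by rewrite BZ IH.
Qed.

(** Each pair raises an entry by less than [N p]. Agreement on bounded vectors is all that is
    available later, since [B_v_mul] needs [k < N]. *)
Lemma opsum_ext l N f g (al : nat -> int) (C : int) : (forall k, (al k <= C)%R) ->
  (forall be, (forall k, (be k <= C + (\sum_(p <- l) N p)%N%:Z)%R) -> f be = g be) ->
  opsum l N f al = opsum l N g al.
Proof.
elim: l C al => [|p l IH] C al alC fg /=.
  by apply: fg => k; rewrite big_nil addr0.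
apply: eq_bigr => a _; apply: eq_bigr => b _; congr (_ *: _).
apply: (IH (C + (N p)%:Z)) => [k|be beC].
  rewrite /act; have := alC k; have := ltn_ord b.
  by case: eqP => _; case: eqP => _; lia.
by apply: fg => k; rewrite big_cons; have := beC k; lia.
Qed.

Lemma opsum_eqf l N f (al al' : nat -> int) :
  (forall be be', be =1 be' -> f be = f be') -> al =1 al' ->
  opsum l N f al = opsum l N f al'.
Proof.
move=> ff; elim: l al al' => [|p l IH] al al' E /=; first exact: ff.
apply: eq_bigr => a _; apply: eq_bigr => b _; congr (_ *: _); apply: IH => k.
by rewrite /act E.
Qed.

Definition icons (m : int) (al : nat -> int) (k : nat) : int :=
  if k is k'.+1 then al k' else m.

Definition shift_pair (p : nat * nat) := (p.1.+1, p.2.+1).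

Lemma act_shift_pair p a b m al : act (shift_pair p) a b (icons m al) =1 icons m (act p a b al).
Proof. by case=> [|k]; rewrite /act //= !mul0r addr0 subr0. Qed.

Lemma vprod_eq n al al' : al =1 al' -> vprod n al = vprod n al'.
Proof. by move=> E; apply: eq_bigr => k _; rewrite E. Qed.

Lemma opsum_shift_pair l N N' f m al :
  (forall be be', be =1 be' -> f be = f be') -> (forall p, N' (shift_pair p) = N p) ->
  opsum (map shift_pair l) N' f (icons m al) = opsum l N (fun be => f (icons m be)) al.
Proof.
move=> ff NN; elim: l al => //= p l IH al; rewrite NN.
apply: eq_bigr => a _; apply: eq_bigr => b _; rewrite -IH; congr (_ *: _).
exact/opsum_eqf/act_shift_pair.
Qed.

(** The pairs [(0, i)] are absorbed one after the other: [B_v_mul] takes the next [v] out of [B] and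
    changes the two indices exactly as [act] does. *)
Lemma opsum_row N j d (ga : nat -> int) :
  (forall k, (j < k)%N -> (ga k < (N (0, k))%:Z)%R) ->
  opsum [seq (0%N, i) | i <- iota j.+1 d] N (vprod (j + d).+1) ga =
  \prod_(1 <= k < j.+1) v (ga k) * B (ga 0%N) (\prod_(j.+1 <= k < (j + d).+1) v (ga k)).
Proof.
elim: d j ga => [|d IH] j ga gaN /=.
  rewrite addn0 [X in B _ X]big_geq // B1 mulrC /vprod.
  by rewrite -(big_mkord xpredT (fun k => v (ga k))) big_ltn.
rewrite [X in B _ X]big_ltn; last by lia.
rewrite (B_v_mul _ _ (gaN j.+1 (ltnSn j))) mulr_sumr; apply: eq_bigr => a _.
rewrite mulr_sumr; apply: eq_bigr => b _; rewrite -scalerAr addnS -addSn IH; last first.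
  move=> k jk; have := gaN k ltac:(lia).
  by rewrite /act /=; case: (k =P 0%N); case: (k =P j.+1); lia.
congr (_ *: _); rewrite mulrA big_nat_recr //=; congr (_ * v _ * B _ _).
- apply: eq_big_nat => k /andP[k1 kj]; congr v; rewrite /act /=.
  by case: (k =P 0%N); case: (k =P j.+1); lia.
- by rewrite /act /= eqxx mul0r addr0 [_ * _]mul1r opprD addrA.
- by rewrite /act /= mul0r subr0 [_ * _]mul1r addrA addrAC.
apply: eq_big_nat => k /andP[k1 kj]; congr v; rewrite /act /=.
by case: (k =P 0%N); case: (k =P j.+1); lia.
Qed.

(** The pairs not involving row 0 are expanded first and pass through [B] by linearity; the pairs of
    row 0 then rebuild [B]. The bound for row 0 must exceed every entry that the other pairs can
    produce. *)
Lemma opsum_icons n l N N' m (al : nat -> int) (C : int) :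
  (forall p, N' (shift_pair p) = N p) -> (forall k, (al k <= C)%R) ->
  (forall k, (C + (\sum_(p <- l) N p)%N%:Z < (N' (0, k))%:Z)%R) ->
  opsum (map shift_pair l ++ [seq (0%N, i) | i <- iota 1 n]) N' (vprod n.+1) (icons m al)
  = B m (opsum l N (vprod n) al).
Proof.
move=> NN alC CN; rewrite opsum_cat (opsum_shift_pair _ _ _ _ NN); last first.
  by move=> be be' E; apply: opsum_eqf => // ? ? ?; apply: vprod_eq.
rewrite opsum_B; apply: (opsum_ext alC) => be beC.
rewrite (@opsum_row N' 0 n); last first.
  by move=> [|k] // _; have := beC k; have := CN k.+1; rewrite /=; lia.
by rewrite big_geq // mul1r add0n big_add1 /vprod big_mkord.
Qed.
End Expansion.

(** * Raising and lowering operators as translations *)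

Definition Rvec (p : ipair) (k : nat) : int := (k == p.1)%:Z - (k == p.2)%:Z.
Definition Lvec (p : ipair) (k : nat) : int := - (k == p.1)%:Z - (k == p.2)%:Z.

Lemma RopE (p : ipair) (al : ivec) k : Rop p al k = al k + Rvec p k.
Proof.
have p12 : (p.1 < p.2)%N := valP p; rewrite /Rop !fsfun_withE /Rvec addrA.
case: (k =P p.1) => [->|_]; first by rewrite (ltn_eqF p12) subr0.
by case: (k =P p.2) => [->|_]; rewrite addr0 ?subr0.
Qed.

Lemma LopE (p : ipair) (al : ivec) k : Lop p al k = al k + Lvec p k.
Proof.
have p12 : (p.1 < p.2)%N := valP p; rewrite /Lop !fsfun_withE /Lvec.
case: (k =P p.1) => [->|_]; first by rewrite (ltn_eqF p12) subr0.
by case: (k =P p.2) => [->|_]; rewrite oppr0 ?sub0r ?addr0.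
Qed.

Section OpmonSum.
Context (Op : ipair -> ivec -> ivec) (dv : ipair -> nat -> int).
Hypothesis OpE : forall p al k, Op p al k = al k + dv p k.

Lemma iter_OpE p n al k : iter n (Op p) al k = al k + n%:Z * dv p k.
Proof.
elim: n => [|n IH] /=; first by rewrite mul0r addr0.
by rewrite OpE IH -addn1 PoszD mulrDl mul1r addrA.
Qed.

Lemma opmonE s al k :
  opmon Op s al k = al k + \sum_(p <- finsupp s) (s p)%:Z * dv p k.
Proof.
rewrite /opmon; elim: (enum_fset (finsupp s)) => [|p l IH] /=.
  by rewrite big_nil addr0.
by rewrite iter_OpE IH big_cons addrAC addrA.
Qed.
End OpmonSum.

Lemma big_expo_with (R : Type) (idx : R) (op : Monoid.com_law idx)
    (e : expo) p a (F : ipair -> nat -> R) :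
  (forall q, F q 0%N = idx) -> e p = 0%N ->
  \big[op/idx]_(q <- finsupp [fsfun e with p |-> a]) F q ([fsfun e with p |-> a] q)
  = op (F p a) (\big[op/idx]_(q <- finsupp e) F q (e q)).
Proof.
move=> F0 ep; set e' := [fsfun e with p |-> a].
have pe : p \notin finsupp e by rewrite mem_finsupp ep eqxx.
have sub : (finsupp e' `<=` p |` finsupp e)%fset.
  apply/fsubsetP => q; rewrite !inE mem_finsupp /e' fsfun_withE.
  by case: (q =P p) => //= _; rewrite mem_finsupp.
rewrite (big_fset_incl _ sub) => [|q _]; last first.
  by rewrite mem_finsupp negbK => /eqP ->.
rewrite big_fsetU1 //= /e' fsfun_withE eqxx; congr (op _ _).
rewrite [LHS]big_seq [RHS]big_seq; apply: eq_bigr => q qe; rewrite fsfun_withE.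
by case: (q =P p) => // qp; rewrite qp in qe; rewrite qe in pe.
Qed.

(** * From sums over all exponents to truncated operator products *)

Section ExpoSum.
Context (K : comUnitRingType) (A : comAlgType K) (v : int -> A) (g1 g2 : nat -> K).
Hypothesis v0 : v 0 = 1.
Hypothesis g10 : g1 0%N = 1.
Hypothesis g20 : g2 0%N = 1.

Definition term (al : ivec) (e : expo * expo) : A :=
  ((\prod_(p <- finsupp e.1) g1 (e.1 p)) * (\prod_(p <- finsupp e.2) g2 (e.2 p))) *:
  \prod_(i <- finsupp (opmon Lop e.1 (opmon Rop e.2 al)))
     v (opmon Lop e.1 (opmon Rop e.2 al) i).

Definition iact (p : ipair) (a b : nat) (al : ivec) : ivec :=
  iter a (Lop p) (iter b (Rop p) al).

Lemma iactE p a b al k : iact p a b al k = act p a b al k.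
Proof.
rewrite /iact (iter_OpE LopE) (iter_OpE RopE) /act /Rvec /Lvec; ring.
Qed.

Definition upd (e : expo * expo) p a b : expo * expo :=
  ([fsfun e.1 with p |-> a], [fsfun e.2 with p |-> b]).

(** All operators are translations, so the powers at [p] may be applied before the others. *)
Lemma term_upd (al : ivec) (e : expo * expo) p a b : e.1 p = 0%N -> e.2 p = 0%N ->
  term al (upd e p a b) = (g1 a * g2 b) *: term (iact p a b al) e.
Proof.
move=> e1 e2; rewrite /term /upd /=.
rewrite (@big_expo_with _ _ _ e.1 p a (fun=> g1)) // (@big_expo_with _ _ _ e.2 p b (fun=> g2)) //.
rewrite scalerA mulrACA.
suff -> : opmon Lop [fsfun e.1 with p |-> a] (opmon Rop [fsfun e.2 with p |-> b] al)
   = opmon Lop e.1 (opmon Rop e.2 (iact p a b al)) by [].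
apply/fsfunP => k; rewrite !(opmonE LopE) !(opmonE RopE).
rewrite (@big_expo_with _ _ _ e.1 p a (fun q n => n%:Z * Lvec q k)) //; last first.
  by move=> q; rewrite mul0r.
rewrite (@big_expo_with _ _ _ e.2 p b (fun q n => n%:Z * Rvec q k)) //; last first.
  by move=> q; rewrite mul0r.
rewrite iactE /act /Rvec /Lvec /=; ring.
Qed.

Fixpoint expos (l : seq ipair) (N : nat * nat -> nat) : seq (expo * expo) :=
  if l is p :: l' then
    [seq upd x.2 p x.1.1 x.1.2 | x <- [seq (y, e) |
       y <- [seq (a, b) | a <- iota 0 (N p), b <- iota 0 (N p)], e <- expos l' N]]
  else [:: ([fsfun], [fsfun])].

Lemma big_expos (V : nmodType) p l N (F : expo * expo -> V) :
  \sum_(e <- expos (p :: l) N) F e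
  = \sum_(a < N p) \sum_(b < N p) \sum_(e <- expos l N) F (upd e p a b).
Proof.
rewrite /= big_map big_allpairs_dep big_allpairs_dep.
rewrite -(big_mkord xpredT (fun a => \sum_(b < N p) \sum_(e <- expos l N) F (upd e p a b))).
rewrite /index_iota subn0; apply: eq_bigr => a _.
rewrite -(big_mkord xpredT (fun b => \sum_(e <- expos l N) F (upd e p a b))).
by rewrite /index_iota subn0.
Qed.

Lemma mem_expos (l : seq ipair) (N : nat * nat -> nat) (e : expo * expo) :
  uniq l -> reflect
  (forall q : ipair, if q \in l then (e.1 q < N q)%N /\ (e.2 q < N q)%N
             else e.1 q = 0%N /\ e.2 q = 0%N) (e \in expos l N).
Proof.
elim: l e => [|p l IH] e /=.
  move=> _; rewrite inE; apply: (iffP eqP) => [-> q|E]; first by rewrite !fsfun0E.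
  by case: e E => e1 e2 E; congr (_, _); apply/fsfunP => q; rewrite fsfun0E; case: (E q).
case/andP=> pl ul; apply: (iffP mapP) => [[[[a b] e'] + ->]|E].
  case/allpairsP=> -[[a' b'] e''] /= [/allpairsP[[a'' b''] /= [+ + [-> ->]]] e''l [-> -> ->]].
  rewrite !mem_iota /= => aN bN q; rewrite !fsfun_withE inE.
  have [->|qp] /= := eqVneq q p; first by [].
  by apply/(IH e'' ul).
exists ((e.1 p, e.2 p), ([fsfun e.1 with p |-> 0%N], [fsfun e.2 with p |-> 0%N])).
  have := E p; rewrite mem_head => -[e1p e2p].
  apply/allpairsP; exists ((e.1 p, e.2 p), ([fsfun e.1 with p |-> 0%N], [fsfun e.2 with p |-> 0%N])).
  split=> //=; first by apply/allpairsP; exists (e.1 p, e.2 p); rewrite !mem_iota.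
  apply/(IH _ ul) => q /=; rewrite !fsfun_withE; have := E q; rewrite inE.
  by have [->|qp] //= := eqVneq q p; rewrite (negPf pl).
case: e E => e1 e2 /= _; congr (_, _); apply/fsfunP => q; rewrite !fsfun_withE;
  by have [->|] := eqVneq q p.
Qed.

Lemma expos_uniq (l : seq ipair) N : uniq l -> uniq (expos l N).
Proof.
elim: l => //= p l IH /andP[pl ul]; rewrite map_inj_in_uniq.
  by rewrite !allpairs_uniq ?iota_uniq ?IH // => -[? ?] [? ?] _ _ [-> ->].
have e0 e q : e \in expos l N -> q = p -> e.1 q = 0%N /\ e.2 q = 0%N.
  by move=> /(mem_expos _ _ ul)/(_ q) + qp; rewrite qp (negPf pl).
move=> [[a b] e] [[a' b'] e'] /allpairsP[[? f] /= [_ fl [_ ->]]].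
case/allpairsP=> -[? f'] /= [_ f'l [_ ->]] [E1 E2].
have := congr1 (fun f : expo => f p) E1; have := congr1 (fun f : expo => f p) E2.
rewrite !fsfun_withE !eqxx => -> ->; congr (_, _).
case: f f' fl f'l E1 E2 => f1 f2 [f1' f2'] fl f'l E1 E2.
have [/= f1p f2p] := e0 _ p fl erefl; have [/= f1p' f2p'] := e0 _ p f'l erefl.
congr (_, _); apply/fsfunP => q.
  have := congr1 (fun f : expo => f q) E1; rewrite !fsfun_withE /=.
  by have [->|//] := eqVneq q p; rewrite f1p f1p'.
have := congr1 (fun f : expo => f q) E2; rewrite !fsfun_withE /=.
by have [->|//] := eqVneq q p; rewrite f2p f2p'.
Qed.

Lemma sum_expos (l : seq ipair) N n (al : ivec) : uniq l ->
  (forall p : ipair, p \in l -> (p.2 < n)%N) -> (forall k, (n <= k)%N -> al k = 0) ->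
  \sum_(e <- expos l N) term al e
  = opsum g1 g2 [seq val p | p <- l] N (vprod v n) al.
Proof.
elim: l al => [|p l IH] al ul ln aln.
  rewrite big_seq1 /term /= /opmon !finsupp0 /= !big_seq_fset0 mulr1 scale1r.
  rewrite /vprod -(big_mkord xpredT (fun k => v (al k))) /index_iota subn0.
  rewrite [RHS](bigID (mem (finsupp al))) /= [X in _ * X]big1 ?mulr1 => [|k]; last first.
    by rewrite mem_finsupp negbK => /eqP ->.
  rewrite -[RHS]big_filter; apply: perm_big.
  have U : uniq [seq k <- iota 0 n | k \in finsupp al] by rewrite filter_uniq ?iota_uniq.
  apply: uniq_perm; rewrite ?U ?fset_uniq // => k.
  rewrite mem_filter mem_iota add0n /=.
  apply/idP/andP => [kal|[]//]; split=> //; rewrite ltnNge; apply/negP => /aln k0.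
  by move: kal; rewrite mem_finsupp k0 eqxx.
case/andP: ul => pl ul; rewrite big_expos [RHS]/=; apply: eq_bigr => a _; apply: eq_bigr => b _.
have p12 : (p.1 < p.2)%N := valP p; have pn := ln p (mem_head _ _).
rewrite -(@opsum_eqf _ _ g1 g2 _ _ _ (iact p a b al)); last 2 first.
- by move=> ? ?; apply: vprod_eq.
- exact: iactE.
rewrite -IH // => [|q ql|k nk]; last 2 first.
- by apply: ln; rewrite inE ql orbT.
- by rewrite iactE /act aln //; case: (k =P p.1); case: (k =P p.2); lia.
rewrite scaler_sumr big_seq [RHS]big_seq; apply: eq_bigr => e /(mem_expos _ _ ul)/(_ p).
by rewrite (negPf pl) => -[e1 e2]; apply: term_upd.
Qed.

Hypothesis vN : forall n, v (Negz n) = 0.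

(** Let [J] be the largest second index of a pair in use. No such pair has [J] as its first index,
    so entry [J] is only ever lowered; if [n <= J] it ends up negative and its [v] is 0. *)
Lemma term_support (al : ivec) n (e : expo * expo) (q : ipair) :
  (forall k, (n <= k)%N -> al k = 0) ->
  term al e != 0 -> (e.1 q != 0%N) || (e.2 q != 0%N) -> (q.2 < n)%N.
Proof.
move=> aln + eq; apply: contra_neqT; rewrite -leqNgt => nq.
pose X := (finsupp e.1 `|` finsupp e.2)%fset.
have qX : q \in X by rewrite !inE !mem_finsupp.
case: (@arg_maxnP X [` qX]%fset predT (fun x => (val x).2)) => // x _ xmax.
have {xmax} pJ (p : ipair) : p \in X -> (p.2 <= (val x).2)%N.
  by move=> pX; apply: (xmax [` pX]%fset).
set J := (val x).2 in pJ.
have nJ : (n <= J)%N by apply: leq_trans nq (pJ q qX).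
set be := opmon Lop e.1 (opmon Rop e.2 al).
have beJ : be J = - (\sum_(p <- X) (e.1 p + e.2 p) * (J == p.2))%N%:Z.
  rewrite /be (opmonE LopE) (opmonE RopE) aln // add0r.
  rewrite (big_fset_incl _ (fsubsetUr (finsupp e.1) (finsupp e.2))) /=; last first.
    by move=> p _; rewrite mem_finsupp negbK => /eqP ->; rewrite mul0r.
  rewrite (big_fset_incl _ (fsubsetUl (finsupp e.1) (finsupp e.2))) /=; last first.
    by move=> p _; rewrite mem_finsupp negbK => /eqP ->; rewrite mul0r.
  rewrite -big_split (big_morph Posz PoszD (erefl 0%:Z)) -sumrN.
  rewrite [LHS]big_seq [RHS]big_seq; apply: eq_bigr => p /pJ pJ'.
  have p12 : (p.1 < p.2)%N := valP p.
  rewrite /Rvec /Lvec (gtn_eqF (leq_trans p12 pJ')) /= oppr0 sub0r -mulrDl.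
  by rewrite mulrN -PoszD -PoszM addnC.
have beJ0 : (be J < 0)%R.
  rewrite beJ (big_fsetD1 (val x)) ?fsvalP //= eqxx muln1.
  have := fsvalP x; rewrite {2}/X !inE !mem_finsupp; lia.
rewrite /term -/be (big_fsetD1 J) /=; last first.
  by rewrite mem_finsupp; apply/eqP => b0; rewrite b0 in beJ0.
have -> : v (be J) = 0 by case: (be J) beJ0 => // m _; apply: vN.
by rewrite mul0r scaler0.
Qed.

(** The order is the one in which [opsum_icons] peels off the first row. *)
Fixpoint pairs (n : nat) : seq (nat * nat) :=
  if n is n'.+1 then map shift_pair (pairs n') ++ [seq (0%N, i) | i <- iota 1 n'] else [::].

Lemma mem_pairs n p : (p \in pairs n) = (p.1 < p.2)%N && (p.2 < n)%N.
Proof.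
elim: n p => [|n IH] [i j] /=; first by rewrite andbF.
rewrite mem_cat; apply/orP/idP => [[/mapP[[i' j'] + [-> ->]]|/mapP[k + [-> ->]]]|].
- by rewrite IH.
- by rewrite mem_iota add1n => /andP[k0 kn]; rewrite k0.
case: i => [|i]; case: j => [|j] //= ijn.
  by right; apply/mapP; exists j.+1 => //; rewrite mem_iota.
by left; apply/mapP; exists (i, j) => //; rewrite IH.
Qed.

Lemma pairs_uniq n : uniq (pairs n).
Proof.
elim: n => //= n IH; rewrite cat_uniq !map_inj_uniq ?iota_uniq ?IH /= => [| |].
- by rewrite andbT; apply/hasPn => p /mapP[k _ ->]; apply/mapP => -[? ? []].
- by move=> ? ? [].
- by move=> [? ?] [? ?] [-> ->].
Qed.

Definition ipairs n : seq ipair := pmap insub (pairs n).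

Lemma ipairsE n : [seq val p | p <- ipairs n] = pairs n.
Proof.
rewrite /ipairs pmap_filter; last exact: insubK.
by apply/all_filterP/allP => p; rewrite mem_pairs isSome_insub => /andP[].
Qed.

Lemma mem_ipairs n (q : ipair) : (q \in ipairs n) = (q.2 < n)%N.
Proof. by rewrite mem_pmap_sub mem_pairs (valP q). Qed.

(** The bounds may vary with the pair as long as they are at least [N0]; the recursion on rows needs
    larger ones for row 0. *)
Lemma fsum_term (al : ivec) n : (forall k, (n <= k)%N -> al k = 0) ->
  finite_set [set e | term al e != 0] ->
  exists N0, forall N, (forall p, (N0 <= N p)%N) ->
    \sum_(e \in [set: expo * expo]) term al e = opsum g1 g2 (pairs n) N (vprod v n) al.
Proof.
move=> aln /finite_seqP[s sE].
exists (\max_(e <- s) maxn (\max_(q <- finsupp e.1) e.1 q) (\max_(q <- finsupp e.2) e.2 q)).+1.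
move=> N N0.
have uip : uniq (ipairs n) by rewrite pmap_sub_uniq ?pairs_uniq.
rewrite -ipairsE -sum_expos //; last by move=> p; rewrite mem_ipairs.
rewrite (fsbigE (expos (ipairs n) N)) ?expos_uniq //; first by apply: eq_bigl => e; rewrite in_setT.
move=> e _; apply: contraNeq => te; apply/(mem_expos _ _ uip) => q; rewrite mem_ipairs.
have supp := @term_support al n e q aln te.
case: ltnP => [qn|nq]; last first.
  split; apply/eqP; apply: contraLR nq => ne; rewrite -ltnNge; apply: supp; rewrite ne ?orbT //.
have es : e \in s by have : [set` s]%classic e by rewrite -sE.
have tr m : (m <= maxn (\max_(q <- finsupp e.1) e.1 q) (\max_(q <- finsupp e.2) e.2 q))%N ->
    (m < N q)%N.
  move=> le; apply: leq_trans (N0 q); rewrite ltnS; apply: leq_trans le _.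
  exact: (leq_bigmax_seq e).
have bound (f : expo) : (f q <= \max_(q <- finsupp f) f q)%N.
  have [->//|fq] := eqVneq (f q) 0%N.
  by apply: (leq_bigmax_seq q) => //; rewrite mem_finsupp.
by split; apply: tr; rewrite leq_max bound ?orbT.
Qed.
End ExpoSum.

Lemma ivec_ofE la k : ivec_of la k = (nth 0%N la k)%:Z.
Proof.
rewrite /ivec_of fsfunE seq_fsetE mem_iota add0n; case: ltnP => //= le.
by rewrite nth_default.
Qed.

(** * Peeling off the first row *)

Section Recursion.
Context (K : comUnitRingType) (A : comAlgType K) (v : int -> A) (g1 g2 : nat -> K).
Context (B : int -> A -> A).
Hypothesis v0 : v 0 = 1.
Hypothesis vN : forall n, v (Negz n) = 0.
Hypothesis g10 : g1 0%N = 1.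
Hypothesis g20 : g2 0%N = 1.
Hypothesis BD : forall m, {morph B m : x y / x + y}.
Hypothesis BZ : forall m c x, B m (c *: x) = c *: B m x.
Hypothesis B1 : forall m, B m 1 = v m.
Hypothesis B_v_mul : forall m (k : int) x N, (k < N%:Z)%R ->
  B m (v k * x) = \sum_(a < N) \sum_(b < N)
    (g1 a * g2 b) *: (v (k - a%:Z - b%:Z) * B (m - a%:Z + b%:Z) x).
Hypothesis term_finite : forall al,
  finite_set [set e | term v g1 g2 al e != 0].

Lemma sum_term la : \sum_(e \in [set: expo * expo]) term v g1 g2 (ivec_of la) e
  = foldr (fun m x => B m%:Z x) 1 la.
Proof.
have out l k : (size l <= k)%N -> ivec_of l k = 0.
  by move=> le; rewrite ivec_ofE nth_default.
elim: la => [|m l IH] /=.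
  have [N0 E0] := fsum_term v0 g10 g20 vN (out [::]) (term_finite (ivec_of [::])).
  rewrite (E0 (fun=> N0)) //.
  by rewrite /= /vprod big_ord0.
have [N0 E0] := fsum_term v0 g10 g20 vN (out l) (term_finite (ivec_of l)).
have [N1 E1] := fsum_term v0 g10 g20 vN (out (m :: l)) (term_finite (ivec_of (m :: l))).
pose N (_ : nat * nat) := maxn N0 N1.
(* Entries of [l] are at most [sumn l] and grow by at most the sum of the [N p]; [C] exceeds that as
   well as [N0] and [N1]. *)
pose C := (sumn l + \sum_(p <- pairs (size l)) N p + maxn N0 N1).+1%N.
pose N' (p : nat * nat) := if p.1 is 0%N then C else maxn N0 N1.
rewrite (E1 N') => [|[[|i] j]]; last 2 first.
- by rewrite /N' /C /=; lia.
- by rewrite /N' /= leq_maxr.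
rewrite -IH (E0 N) => [|p]; last exact: leq_maxl.
have alC k : (ivec_of l k <= (sumn l)%:Z)%R.
  rewrite ivec_ofE lez_nat; elim: (l) k => [|x s IHs] [|k] //=; rewrite ?leq_addr //.
  by apply: leq_trans (IHs k) _; rewrite leq_addl.
rewrite -(@opsum_icons _ _ v g1 g2 B BD BZ B1 B_v_mul _ _ N N' m _ (sumn l)%:Z) //; last first.
  by move=> k; rewrite /N' /C /=; lia.
apply: opsum_eqf => [be be'|k]; first exact: vprod_eq.
by rewrite ivec_ofE; case: k => [|k] //=; rewrite ivec_ofE.
Qed.
End Recursion.

(** * Vertical strips *)

Definition down T (M : nat) (f : nat -> T) : seq T := [seq f i | i <- rev (iota 1 M)].

Lemma downS T M (f : nat -> T) : down M.+1 f = f M.+1 :: down M f.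
Proof. by rewrite /down -[in LHS](addn1 M) iotaD add1n rev_cat. Qed.

Lemma size_down T M (f : nat -> T) : size (down M f) = M.
Proof. by rewrite size_map size_rev size_iota. Qed.

Lemma eq_down T M (f g : nat -> T) :
  (forall i, (0 < i <= M)%N -> f i = g i) -> down M f = down M g.
Proof.
move=> fg; rewrite /down; elim: M fg => // M IH fg.
rewrite -!/(down _ _) !downS fg ?leqnn //; congr (_ :: _); apply: IH => i iM; apply: fg; lia.
Qed.

Definition mults M (la : seq nat) := down M (fun i => count_mem i la).

Lemma mpart_le ms x : x \in mpart ms -> (0 < x <= size ms)%N.
Proof.
elim: ms => //= m ms IH; rewrite mem_cat mem_nseq => /orP[/andP[_ /eqP->]|/IH].
  by rewrite leqnn.
by case/andP=> -> /leqW.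
Qed.

Lemma geq_trans : transitive geq.
Proof. by move=> y x z /= yx zy; apply: leq_trans zy yx. Qed.

Lemma mpart_sorted ms : sorted geq (mpart ms).
Proof.
rewrite (sorted_pairwise geq_trans); elim: ms => //= m ms IH.
rewrite pairwise_cat IH andbT; apply/andP; split.
  apply/allrelP => x y; rewrite mem_nseq => /andP[_ /eqP->] /mpart_le /=; lia.
by elim: m => //= m ->; rewrite all_nseq /= leqnn orbT.
Qed.

Lemma mpart_part ms : sorted geq (mpart ms) && (0%N \notin mpart ms).
Proof. by rewrite mpart_sorted; apply/negP => /mpart_le. Qed.

Lemma count_mpart_down x M (f : nat -> nat) :
  count_mem x (mpart (down M f)) = if (0 < x <= M)%N then f x else 0%N.
Proof.
elim: M => [|M IH]; first by case: x.
rewrite downS /= count_cat IH size_down count_nseq /=.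
by case: (eqVneq M.+1 x) => [<-|xM]; rewrite ?mul1n ?mul0n; case: ifP; case: ifP => //; lia.
Qed.

Lemma mpart_mults M (la : seq nat) : sorted geq la -> 0%N \notin la ->
  (forall x, x \in la -> (x <= M)%N) -> mpart (mults M la) = la.
Proof.
move=> sla la0 leM; apply: (sorted_eq geq_trans) => //; last 2 first.
- exact: mpart_sorted.
- apply/allP => x _ /=; rewrite count_mpart_down.
  case: ifP => // /negbT xM; rewrite eq_sym; apply/eqP/count_memPn.
  by apply/negP => xla; have := leM x xla; case: x xla xM => [|x]; rewrite ?(negPf la0) //; lia.
by move=> x y /= /andP[]; lia.
Qed.

Lemma conjp_cat la la' i : conjp (la ++ la') i = (conjp la i + conjp la' i)%N.
Proof. exact: count_cat. Qed.

Lemma conjp_mpart_cons m ms i :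
  conjp (mpart (m :: ms)) i = ((i <= (size ms).+1)%N * m + conjp (mpart ms) i)%N.
Proof. by rewrite /= conjp_cat /conjp count_nseq. Qed.

Lemma conjp_mpart_big ms i : (size ms < i)%N -> conjp (mpart ms) i = 0%N.
Proof.
move=> mi; apply/eqP; rewrite eqn0Ngt -has_count; apply/hasPn => x /mpart_le; lia.
Qed.

Lemma count_conjp la i : (conjp la i = count_mem i la + conjp la i.+1)%N.
Proof. by elim: la => //= x l; rewrite /conjp /=; case: (x =P i); lia. Qed.

Lemma sum_conjp M la : (forall x, x \in la -> (x <= M)%N) ->
  (\sum_(1 <= i < M.+1) conjp la i)%N = sumn la.
Proof.
elim: la => [|x l IH] leM; first by rewrite big1.
rewrite /= -IH => [|y yl]; last by apply: leM; rewrite inE yl orbT.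
rewrite /conjp /= big_split /=; congr (_ + _)%N.
have xM : (x <= M)%N by apply: leM; rewrite mem_head.
rewrite -[RHS](minn_idPl xM); elim: (M) => [|n IHn]; first by rewrite big_geq ?minn0.
by rewrite big_nat_recr //= IHn; lia.
Qed.

Lemma nth_conjp la i k : sorted geq la -> (0 < i)%N ->
  (i <= nth 0 la k)%N = (k < conjp la i)%N.
Proof.
move=> + i0; rewrite (sorted_pairwise geq_trans).
elim: la k => [|x l IH] k /=; first by rewrite nth_nil; lia.
case/andP=> /allP xl sl; rewrite /conjp /= -/(conjp l i).
have [ix|xi] := leqP i x; first by case: k => [|k] /=; [rewrite ix; lia|rewrite IH].
have -> : conjp l i = 0%N.
  by apply/eqP; rewrite eqn0Ngt -has_count; apply/hasPn => y /xl /=; lia.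
case: k => [|k] /=; first by lia.
case: (ltnP k (size l)) => [kl|lk]; last by rewrite nth_default //; lia.
by have := xl _ (mem_nth 0%N kl) => /=; lia.
Qed.

(** A vertical strip becomes a horizontal one under conjugation, and horizontal strips are
    interlacings. *)
Lemma vstrip_conjp (mu nu : seq nat) : sorted geq mu -> sorted geq nu ->
  (forall i, nth 0 nu i <= nth 0 mu i <= (nth 0 nu i).+1)%N <->
  (forall i, 0 < i -> conjp mu i.+1 <= conjp nu i <= conjp mu i)%N.
Proof.
move=> smu snu; split=> [S i i0|S k].
  apply/andP; split; rewrite leqNgt; apply/negP.
    rewrite -nth_conjp //; have := S (conjp nu i) => /andP[_ le] lt.
    by have := ltnn (conjp nu i); rewrite -(@nth_conjp nu i) // => /negP; apply; lia.
  rewrite -nth_conjp //; have := S (conjp mu i) => /andP[le _] lt.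
  by have := ltnn (conjp mu i); rewrite -(@nth_conjp mu i) // => /negP; apply; lia.
apply/andP; split.
  case E : (nth 0 nu k) => [|i] //; rewrite nth_conjp //.
  have /andP[_ le] := S i.+1 isT; apply: leq_trans le.
  by rewrite -nth_conjp // E.
case E : (nth 0 mu k) => [|[|i]] //; rewrite ltnS nth_conjp //.
have /andP[le _] := S i.+1 isT; apply: leq_trans le.
by rewrite -nth_conjp // E.
Qed.

(** * Strips obtained by lowering parts *)

Lemma choices_cons j js m ms :
  (j :: js \in choices (m :: ms)) = (j <= m)%N && (js \in choices ms).
Proof. by rewrite !mem_choices /= eqSS andbCA. Qed.

Lemma conjp_lower c ms js i : js \in choices ms -> (0 < i <= size ms)%N ->
  (conjp (mpart ms) i.+1 + c <= conjp (mpart (lower c ms js)) i <= conjp (mpart ms) i + c)%N.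
Proof.
elim: ms js c => [|m ms IH] [|j js] c; rewrite ?choices_cons.
- by move=> _ /andP[]; case: i.
- by rewrite mem_choices.
- by rewrite mem_choices.
case/andP=> jm jsms iM0; rewrite [lower _ _ _]/= !conjp_mpart_cons size_lower //.
rewrite /= in iM0.
have [iM|Mi] : (i <= size ms)%N \/ i = (size ms).+1 by lia.
  by have := IH js j jsms ltac:(lia); rewrite !(leqW iM) ltnS iM; lia.
by rewrite Mi !conjp_mpart_big ?size_lower // ltnn leqnn; lia.
Qed.

(** Lowering a part equal to [i] removes a box from column [i], so the choice is recovered from the
    column lengths; this yields injectivity in the reindexing of strips. *)
Lemma diff_lower c ms js : js \in choices ms ->
  js = down (size ms) (fun i => conjp (mpart ms) i + c - conjp (mpart (lower c ms js)) i)%N.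
Proof.
elim: ms js c => [|m ms IH] [|j js] c; first by [].
- by rewrite mem_choices.
- by rewrite mem_choices.
rewrite choices_cons => /andP[jm jsms]; rewrite [size _]/= downS.
rewrite [lower _ _ _]/= !conjp_mpart_cons size_lower // leqnn !conjp_mpart_big ?size_lower //.
congr (_ :: _); first by lia.
rewrite {1}(IH js j jsms); apply: eq_down => i iM.
by rewrite !conjp_mpart_cons size_lower // !(leqW (proj2 (andP iM))); lia.
Qed.

Lemma choices_down M f g : (down M g \in choices (down M f)) = all (fun i => g i <= f i)%N (iota 1 M).
Proof.
elim: M => [|M IH]; first by [].
by rewrite !downS choices_cons IH -[in RHS](addn1 M) iotaD all_cat add1n /= andbT andbC.
Qed.

Lemma lower_diff M c (mu nu : seq nat) :
  (forall i, 0 < i -> conjp mu i.+1 <= conjp nu i <= conjp mu i)%N ->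
  c = (conjp mu M.+1 - conjp nu M.+1)%N ->
  lower c (mults M mu) (down M (fun i => conjp mu i - conjp nu i)%N) = mults M nu.
Proof.
move=> S; elim: M c => [|M IH] c cE; first by [].
rewrite /mults !downS /= -/(mults _ _) IH //; congr (_ :: _).
have := S M.+1 isT; have := S M.+2 isT; rewrite cE.
have cntE la : count_mem M.+1 la = (conjp la M.+1 - conjp la M.+2)%N.
  by rewrite count_conjp addnK.
by rewrite !cntE; lia.
Qed.

Lemma sumn_down M f : sumn (down M f) = (\sum_(1 <= i < M.+1) f i)%N.
Proof.
by elim: M => [|M IH]; [rewrite big_geq|rewrite downS big_nat_recr //= IH addnC].
Qed.

Lemma vstrip_lower ms js : js \in choices ms ->
  vstrip (sumn js) (mpart ms) (mpart (lower 0 ms js)).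
Proof.
move=> jsms; split.
  apply/vstrip_conjp; rewrite ?mpart_sorted // => i i0.
  have [iM|Mi] := leqP i (size ms).
    by have := conjp_lower 0 jsms (i := i); rewrite !addn0; apply; rewrite i0.
  by rewrite !conjp_mpart_big ?size_lower //; lia.
rewrite {2}(diff_lower 0 jsms) sumn_down.
rewrite -(@sum_conjp (size ms) (mpart ms)) => [|x /mpart_le/andP[]//].
rewrite -(@sum_conjp (size ms) (mpart (lower 0 ms js))) => [|x /mpart_le]; last first.
  by rewrite size_lower // => /andP[].
rewrite -big_split big_nat_cond [RHS]big_nat_cond /=; apply: eq_bigr => i /andP[iM _].
by have := conjp_lower 0 jsms (i := i) ltac:(lia); lia.
Qed.

Lemma vstrip_lower_exists M a (mu nu : seq nat) :
  sorted geq mu && (0%N \notin mu) -> sorted geq nu && (0%N \notin nu) ->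
  (forall x, x \in mu -> (x <= M)%N) -> vstrip a mu nu ->
  exists2 js, (js \in choices (mults M mu)) && (sumn js == a)
     & nu = mpart (lower 0 (mults M mu) js).
Proof.
move=> /andP[smu mu0] /andP[snu nu0] muM [/(vstrip_conjp smu snu) S szE].
have big la i : (forall x, x \in la -> (x <= M)%N) -> (M < i)%N -> conjp la i = 0%N.
  move=> laM Mi; apply/eqP; rewrite eqn0Ngt -has_count; apply/hasPn => x /laM; lia.
have nuM x : x \in nu -> (x <= M)%N.
  move=> xnu; have := S M.+1 isT; rewrite (big mu M.+1) // => /andP[_]; rewrite leqn0 => /eqP c0.
  by rewrite leqNgt; apply: contra_eqN c0 => Mx; rewrite -lt0n -has_count; apply/hasP; exists x.
exists (down M (fun i => conjp mu i - conjp nu i)%N); last first.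
  by rewrite lower_diff ?mpart_mults // !big.
rewrite choices_down; apply/andP; split.
  apply/allP => i; rewrite mem_iota => iM; have := S i ltac:(lia).
  by rewrite (_ : count_mem i mu = (conjp mu i - conjp mu i.+1)%N) ?[conjp mu i in RHS]count_conjp ?addnK; lia.
rewrite sumn_down; apply/eqP.
have := @sum_conjp M mu muM; have := @sum_conjp M nu nuM; rewrite szE => <-.
have : (\sum_(1 <= i < M.+1) conjp mu i = \sum_(1 <= i < M.+1) (conjp nu i + (conjp mu i - conjp nu i)))%N.
  rewrite big_nat_cond [RHS]big_nat_cond; apply: eq_bigr => i iM.
  by have := S i ltac:(lia); lia.
by rewrite big_split /=; lia.
Qed.

Definition mkpart (ms : seq nat) : intpart := IntPart (mpart_part ms).

Lemma fsbig_seq_map (V : nmodType) (P : intpart -> Prop) (r : seq (seq nat))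
    (g : seq nat -> intpart) (F : intpart -> V) :
  uniq r -> {in r &, injective g} -> (forall js, js \in r -> P (g js)) ->
  (forall la, P la -> exists2 js, js \in r & la = g js) ->
  \sum_(la \in [set la | P la]%classic) F la = \sum_(js <- r) F (g js).
Proof.
move=> ur gi gP Pg.
have -> : [set la | P la]%classic = [set` [seq g js | js <- r]]%classic.
  apply/seteqP; split=> la /=; first by move/Pg=> [js jsr ->]; apply: map_f.
  by case/mapP=> js jsr ->; apply: gP.
by rewrite -fsbig_seq ?map_inj_in_uniq // big_map.
Qed.

Lemma sum_vstrip_lower (V : nmodType) M a (mu : intpart) (F : seq nat -> V) :
  (forall x, x \in (mu : seq nat) -> (x <= M)%N) ->
  \sum_(nu \in [set nu : intpart | vstrip a mu nu]%classic) F nu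
  = \sum_(js <- choices (mults M mu) | sumn js == a) F (mpart (lower 0 (mults M mu) js)).
Proof.
move=> muM; have /andP[smu mu0] := valP mu; have mE := mpart_mults smu mu0 muM.
rewrite -[RHS]big_filter.
have := @fsbig_seq_map V (fun nu : intpart => vstrip a mu nu)
  [seq js <- choices (mults M mu) | sumn js == a]
  (fun js => mkpart (lower 0 (mults M mu) js)) (fun nu => F nu); apply.
- by rewrite filter_uniq ?choices_uniq.
- move=> js js'; rewrite !mem_filter => /andP[_ jsM] /andP[_ jsM'] /(congr1 partval) /= E.
  by rewrite (diff_lower 0 jsM) (diff_lower 0 jsM') E.
- move=> js; rewrite mem_filter => /andP[/eqP<- jsM].
  by rewrite -{1}mE; apply: vstrip_lower.
move=> la S; have [js jsM laE] := vstrip_lower_exists (valP mu) (valP la) muM S.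
by exists js; [rewrite mem_filter andbC|apply: val_inj].
Qed.

(** * Strips obtained by raising parts *)

Lemma size_raise c ms js : js \in choices ms -> size (raise c ms js) = (size ms).+1.
Proof. by move=> jsms; rewrite /= size_raise_tail. Qed.

Lemma conjp_raise_cons c m ms j js i : (j <= m)%N -> js \in choices ms ->
  (i <= (size ms).+1)%N ->
  conjp (mpart (raise c (m :: ms) (j :: js))) i = (m + conjp (mpart (raise c ms js)) i)%N.
Proof.
move=> jm jsms iM; rewrite /raise [raise_tail _ (_ :: _) _]/= !conjp_mpart_cons.
by rewrite [size (_ :: _)]/= !size_raise_tail // iM (leqW iM) !mul1n /=; lia.
Qed.

Lemma conjp_raise_top c ms js : js \in choices ms ->
  conjp (mpart (raise c ms js)) (size ms).+1 = head c js.
Proof.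
move=> jsms; rewrite /raise conjp_mpart_cons size_raise_tail // leqnn mul1n.
by rewrite conjp_mpart_big ?addn0 // size_raise_tail.
Qed.

Lemma conjp_raise c ms js i : js \in choices ms -> (0 < i)%N ->
  (conjp (mpart (raise c ms js)) i.+1 <= conjp (mpart ms) i <= conjp (mpart (raise c ms js)) i)%N.
Proof.
move=> + i0; elim: ms js => [|m ms IH] [|j js]; rewrite ?choices_cons.
- by rewrite conjp_mpart_big.
- by rewrite mem_choices.
- by rewrite mem_choices.
case/andP=> jm jsms; have jsms' : j :: js \in choices (m :: ms) by rewrite choices_cons jm.
have [iM|[iM|iM]] : (i <= size ms)%N \/ i = (size ms).+1 \/ (size (m :: ms) < i)%N.
- by rewrite /=; lia.
- rewrite !conjp_raise_cons //; try lia.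
  by rewrite conjp_mpart_cons (leqW iM) mul1n !leq_add2l; apply: IH.
- rewrite iM (conjp_raise_top c jsms') conjp_raise_cons //.
  by rewrite conjp_mpart_cons leqnn mul1n conjp_mpart_big //=; lia.
by rewrite conjp_mpart_big ?size_raise // conjp_mpart_big.
Qed.

(** Raising a part equal to [i] adds a box to column [i + 1]; column 1 records the [c] new parts
    instead. *)
Lemma diff_raise c ms js : js \in choices ms ->
  js = down (size ms) (fun i => conjp (mpart (raise c ms js)) i.+1 - conjp (mpart ms) i.+1)%N.
Proof.
elim: ms js => [|m ms IH] [|j js]; rewrite ?choices_cons //; try by rewrite mem_choices.
case/andP=> jm jsms; have jsms' : j :: js \in choices (m :: ms) by rewrite choices_cons jm.
rewrite [size _]/= downS (conjp_raise_top c jsms') conjp_mpart_big // subn0.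
congr (_ :: _); rewrite {1}(IH js jsms); apply: eq_down => i iM.
by rewrite conjp_raise_cons ?conjp_mpart_cons //; lia.
Qed.

Lemma conjp1_raise c ms js : js \in choices ms ->
  conjp (mpart (raise c ms js)) 1 = (conjp (mpart ms) 1 + c)%N.
Proof.
elim: ms js => [|m ms IH] [|j js]; rewrite ?choices_cons; try by rewrite mem_choices.
  by rewrite /= cats0 /conjp count_nseq mul1n.
case/andP=> jm jsms; rewrite conjp_raise_cons // IH // conjp_mpart_cons //.
by rewrite mul1n addnA.
Qed.

Lemma vstrip_raise c ms js : js \in choices ms ->
  vstrip (sumn js + c) (mpart (raise c ms js)) (mpart ms).
Proof.
move=> jsms; split.
  by apply/vstrip_conjp; rewrite ?mpart_sorted // => i i0; apply: conjp_raise.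
have -> : sumn js = (\sum_(1 <= i < (size ms).+1)
     (conjp (mpart (raise c ms js)) i.+1 - conjp (mpart ms) i.+1))%N.
  by rewrite -sumn_down -diff_raise.
rewrite -(@sum_conjp (size ms).+1 (mpart ms)) => [|x /mpart_le]; last by lia.
rewrite -(@sum_conjp (size ms).+1 (mpart (raise c ms js))) => [|x /mpart_le]; last first.
  by rewrite size_raise //; lia.
rewrite !(big_nat_recl (size ms).+1 1) // conjp1_raise //.
suff -> : (\sum_(1 <= i < (size ms).+1) conjp (mpart (raise c ms js)) i.+1
  = \sum_(1 <= i < (size ms).+1) (conjp (mpart ms) i.+1 +
     (conjp (mpart (raise c ms js)) i.+1 - conjp (mpart ms) i.+1)))%N.
  by rewrite big_split /=; lia.
apply: eq_big_nat => i _; have := conjp_raise c (i := i.+1) jsms isT; lia.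
Qed.

Lemma raise_tail_diff M c (la nu : seq nat) :
  (forall i, 0 < i -> conjp la i.+1 <= conjp nu i <= conjp la i)%N ->
  c = (conjp la 1 - conjp nu 1)%N ->
  raise_tail c (mults M nu) (down M (fun i => conjp la i.+1 - conjp nu i.+1)%N)
   = mults M la.
Proof.
move=> S cE; elim: M => [|M IH]; first by [].
rewrite /mults !downS /= -!/(mults _ _) IH; congr (_ :: _).
have cntE l : count_mem M.+1 l = (conjp l M.+1 - conjp l M.+2)%N.
  by rewrite count_conjp addnK.
have -> : head c (down M (fun i => conjp la i.+1 - conjp nu i.+1)%N)
   = (conjp la M.+1 - conjp nu M.+1)%N.
  by case: (M) => // M'; rewrite downS.
by rewrite !cntE; have := S M.+1 isT; have := S M.+2 isT; lia.
Qed.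

Lemma vstrip_raise_exists M b (la nu : seq nat) :
  sorted geq la && (0%N \notin la) -> sorted geq nu && (0%N \notin nu) ->
  (forall x, x \in nu -> (x <= M)%N) -> vstrip b la nu ->
  exists2 js, (js \in choices (mults M nu)) && (sumn js <= b)%N
     & la = mpart (raise (b - sumn js) (mults M nu) js).
Proof.
move=> /andP[sla la0] /andP[snu nu0] nuM [/(vstrip_conjp sla snu) S szE].
have big l k i : (forall x, x \in l -> (x <= k)%N) -> (k < i)%N -> conjp l i = 0%N.
  move=> lk Mi; apply/eqP; rewrite eqn0Ngt -has_count; apply/hasPn => x /lk; lia.
have laM x : x \in la -> (x <= M.+1)%N.
  move=> xla; have := S M.+1 isT; rewrite (big nu M) // => /andP[+ _].
  rewrite leqn0 => /eqP c0.
  by rewrite leqNgt; apply: contra_eqN c0 => Mx; rewrite -lt0n -has_count; apply/hasP; exists x.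
set js := down M (fun i => conjp la i.+1 - conjp nu i.+1)%N.
have jsc : js \in choices (mults M nu).
  rewrite choices_down; apply/allP => i; rewrite mem_iota => iM; have := S i ltac:(lia).
  rewrite (_ : count_mem i nu = (conjp nu i - conjp nu i.+1)%N).
    by lia.
  by rewrite [conjp nu i]count_conjp addnK.
have bE : b = (sumn js + (conjp la 1 - conjp nu 1))%N.
  have := @sum_conjp M.+1 la laM.
  have := @sum_conjp M.+1 nu (fun x xnu => leqW (nuM x xnu)); rewrite szE => <-.
  rewrite !(big_nat_recl M.+1 1) // sumn_down.
  have -> : (\sum_(1 <= i < M.+1) conjp la i.+1
      = \sum_(1 <= i < M.+1) (conjp nu i.+1 + (conjp la i.+1 - conjp nu i.+1)))%N.
    by apply: eq_big_nat => i _; have := S i.+1 isT; lia.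
  by rewrite big_split /=; have := S 1%N isT; lia.
exists js; first by rewrite jsc bE leq_addr.
rewrite bE addKn /raise raise_tail_diff //.
(* For [M = 0] the list [js] is empty, and the default of [head] counts the new parts 1, which are
   then the largest. *)
have -> : head (conjp la 1 - conjp nu 1)%N js = count_mem M.+1 la.
  have -> : count_mem M.+1 la = conjp la M.+1 by rewrite count_conjp (big la M.+1) ?addn0.
  rewrite /js; case: (M) nuM => [|M'] nuM; last by rewrite downS /= (big nu M'.+1) ?subn0.
  by rewrite /= (big nu 0%N) ?subn0.
by rewrite -[_ :: _](downS M (fun i => count_mem i la)) mpart_mults.
Qed.

Lemma sum_vstrip_raise (V : nmodType) M b (nu : intpart) (F : seq nat -> V) :
  (forall x, x \in (nu : seq nat) -> (x <= M)%N) ->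
  \sum_(la \in [set la : intpart | vstrip b la nu]%classic) F la
  = \sum_(js <- choices (mults M nu) | (sumn js <= b)%N)
      F (mpart (raise (b - sumn js) (mults M nu) js)).
Proof.
move=> nuM; have /andP[snu nu0] := valP nu; have mE := mpart_mults snu nu0 nuM.
rewrite -[RHS]big_filter.
have := @fsbig_seq_map V (fun la : intpart => vstrip b la nu)
  [seq js <- choices (mults M nu) | (sumn js <= b)%N]
  (fun js => mkpart (raise (b - sumn js) (mults M nu) js)) (fun la => F la); apply.
- by rewrite filter_uniq ?choices_uniq.
- move=> js js'; rewrite !mem_filter => /andP[_ jsM] /andP[_ jsM'] /(congr1 partval) /= E.
  by rewrite (diff_raise (b - sumn js) jsM) (diff_raise (b - sumn js') jsM') /raise /= E.
- move=> js; rewrite mem_filter => /andP[le jsM].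
  by have := vstrip_raise (b - sumn js) jsM; rewrite subnKC // mE.
move=> la S; have [js jsM laE] := vstrip_raise_exists (valP la) (valP nu) nuM S.
by exists js; [rewrite mem_filter andbC|apply: val_inj].
Qed.

(** * Pieri coefficients *)

Lemma tvar_exp_neq1 k : 1 - tvar ^+ k.+1 != 0.
Proof.
rewrite /tvar -tofracXn -tofrac1 -tofracB tofrac_eq0 subr_eq0 eq_sym.
apply/eqP => /(congr1 (fun p : {poly rat} => size p)).
by rewrite size_polyXn size_poly1.
Qed.

Lemma tvar_unit k : 1 - tvar ^+ k.+1 \is a GRing.unit.
Proof. by rewrite unitfE tvar_exp_neq1. Qed.

Lemma ph_tvar_neq0 r : ph tvar r != 0.
Proof. by rewrite -unitfE; apply: (phU tvar_unit). Qed.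

Lemma qbin_qb m j : (j <= m)%N -> qbin m j = qb tvar m j.
Proof.
move=> jm; rewrite /qbin /qb jm.
have E : \prod_(k < j) (1 - tvar ^ (m%:Z - k%:Z)) * ph tvar (m - j) = ph tvar m.
  elim: j jm => [|j IH] jm; first by rewrite big_ord0 mul1r subn0.
  rewrite big_ord_recr /= subzn 1?ltnW // -IH 1?ltnW // -mulrA; congr (_ * _).
  by rewrite mulrC (_ : (m - j = (m - j.+1).+1)%N) ?[RHS]phS //; lia.
rewrite -E -/(ph tvar j) invfM [(ph tvar j)^-1 * _]mulrC mulrA mulfK ?ph_tvar_neq0 //.
Qed.

Lemma qbs_down M f g :
  qbs tvar (down M f) (down M g) = \prod_(1 <= i < M.+1) qb tvar (f i) (g i).
Proof.
elim: M => [|M IH]; first by rewrite big_geq.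
by rewrite !downS big_nat_recr //= IH mulrC.
Qed.

Lemma le_head (la : seq nat) x : sorted geq la -> x \in la -> (x <= head 0%N la)%N.
Proof.
case: la => //= y l; rewrite (path_sortedE geq_trans) inE => /andP[/allP yl _].
by case/orP=> [/eqP->|/yl].
Qed.

Lemma conjp_head (la : seq nat) i : sorted geq la -> (head 0%N la < i)%N -> conjp la i = 0%N.
Proof.
move=> sla hi; apply/eqP; rewrite eqn0Ngt -has_count; apply/hasPn => x /(le_head sla) /=; lia.
Qed.

Lemma count_mem_conjp la i : count_mem i la = (conjp la i - conjp la i.+1)%N.
Proof. by rewrite count_conjp addnK. Qed.

Lemma conjpS_le la i : (conjp la i.+1 <= conjp la i)%N.
Proof. by rewrite [leqRHS]count_conjp leq_addl. Qed.

Lemma widen_prod (F : nat -> Qt) m n : (m <= n)%N ->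
  (forall i, (m < i)%N -> F i = 1) ->
  \prod_(1 <= i < m.+1) F i = \prod_(1 <= i < n.+1) F i.
Proof.
move=> mn F1; elim: n mn => [|n IH]; first by rewrite leqn0 => /eqP ->.
rewrite leq_eqVlt => /orP[/eqP->//|mn].
by rewrite [RHS]big_nat_recr //= -IH // F1 // mulr1.
Qed.

Lemma bpart_widen (la : seq nat) n : sorted geq la -> (head 0%N la <= n)%N ->
  bpart la = \prod_(1 <= i < n.+1) ph tvar (count_mem i la).
Proof.
move=> sla hn; rewrite -(widen_prod hn) // => i hi.
by rewrite count_mem_conjp !conjp_head ?ph0 // ltnW.
Qed.

Lemma fcoef_widen (la mu : seq nat) a n : sorted geq la -> sorted geq mu ->
  vstrip a la mu -> (head 0%N la <= n)%N ->
  fcoef la mu a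
   = \prod_(1 <= i < n.+1) qb tvar (count_mem i la) (conjp la i - conjp mu i).
Proof.
move=> sla smu V hn; rewrite /fcoef asboolT //.
have [/(vstrip_conjp sla smu) S _] := V.
rewrite -(@widen_prod (fun i => qb tvar _ _) _ _ hn) => [|i hi]; last first.
  by rewrite count_mem_conjp !(conjp_head sla) ?qb0 ?(leqW hi) //; apply: tvar_unit.
apply: eq_big_nat => i /andP[i0 _]; have := S i i0; have := conjpS_le la i => le1 /andP[le2 le3].
by rewrite !subzn // count_mem_conjp qbin_qb //; lia.
Qed.

Lemma fcoef_lower (mu : intpart) js :
  js \in choices (mults (head 0%N mu) mu) ->
  fcoef mu (mpart (lower 0 (mults (head 0%N mu) mu) js)) (sumn js)
   = qbs tvar (mults (head 0%N mu) mu) js.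
Proof.
set M := head 0%N mu => jsM; have /andP[smu mu0] : sorted geq mu && (0%N \notin (mu : seq nat)) := valP mu.
have mE : mpart (mults M mu) = mu by apply: mpart_mults => // x; apply: le_head.
have V := vstrip_lower jsM; rewrite mE in V.
rewrite (fcoef_widen smu (mpart_sorted _) V (leqnn _)).
rewrite {2}(diff_lower 0 jsM) size_down qbs_down.
by apply: eq_big_nat => i _; rewrite mE addn0.
Qed.

Lemma telescope_step (F : fieldType) (P L Q R x1 y z n l p : F) :
  l != 0 -> y != 0 -> z != 0 -> p != 0 ->
  P / L * Q = R * y / x1 ->
  P * n / (L * l) * (Q * (l / (y * p))) = R * (n / (z * p)) * z / x1.
Proof.
move=> l0 y0 z0 p0 E; transitivity (P / L * Q * (n / (y * p))).
  by rewrite invfM; move: L^-1 => L'; field; rewrite ?l0 ?y0 ?p0.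
by rewrite E; move: x1^-1 => x'; field; rewrite ?z0 ?y0 ?p0.
Qed.

(** [n] and [l] are the multiplicities of the inner and outer partition, [x i] the number of boxes
    added to column [i]. Since [l i - x i = n i - x i.+1] counts the parts [i] that stay, each
    factor on the left is the t-binomial on the right times [ph (x i.+1) / ph (x i)]. *)
Lemma telescope_qb (n l x : nat -> nat) M :
  (forall i, 0 < i -> l i + x i.+1 = n i + x i)%N -> (forall i, 0 < i -> x i <= l i)%N ->
  \prod_(1 <= i < M.+1) ph tvar (n i) / \prod_(1 <= i < M.+1) ph tvar (l i)
    * \prod_(1 <= i < M.+1) qb tvar (l i) (x i)
  = \prod_(1 <= i < M.+1) qb tvar (n i) (x i.+1) * ph tvar (x M.+1) / ph tvar (x 1%N).
Proof.
move=> lx xl; elim: M => [|M IH].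
  by rewrite !big_geq // divr1 !mul1r divff ?ph_tvar_neq0.
rewrite !(big_nat_recr M.+1) //=.
have lxM := lx M.+1 isT; have xlM := xl M.+1 isT.
have qbE j k : (j <= k)%N -> qb tvar k j = ph tvar k / (ph tvar j * ph tvar (k - j)).
  by move=> jk; rewrite /qb jk.
rewrite (qbE _ _ xlM) (qbE (x M.+2)); last by lia.
rewrite (_ : (n M.+1 - x M.+2 = l M.+1 - x M.+1)%N); last by lia.
by apply: telescope_step; rewrite ?ph_tvar_neq0.
Qed.

Lemma coef_raise (nu : intpart) js c :
  js \in choices (mults (head 0%N nu) nu) ->
  let la := mpart (raise c (mults (head 0%N nu) nu) js) in
  bpart nu / bpart la * fcoef la nu (sumn js + c)
   = qbs tvar (mults (head 0%N nu) nu) js / ph tvar c.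
Proof.
set M := head 0%N nu => jsM la; have /andP[snu nu0] : sorted geq nu && (0%N \notin (nu : seq nat)) := valP nu.
have mE : mpart (mults M nu) = nu by apply: mpart_mults => // x; apply: le_head.
have V := vstrip_raise c jsM; rewrite mE -/la in V.
have sla : sorted geq la by apply: mpart_sorted.
have [/(vstrip_conjp sla snu) S _] := V.
have hla : (head 0%N la <= M.+1)%N.
  case E : la => [|x l] //=; have /mpart_le : x \in la by rewrite E mem_head.
  by rewrite size_raise // size_down => /andP[].
rewrite (bpart_widen snu (n := M.+1)) ?leqnSn // (bpart_widen sla hla).
rewrite (fcoef_widen sla snu V hla).
(* The telescoping ends at [x 1 = c] and at [x M.+2 = 0], because no raised part exceeds [M.+1]. *)
pose x i := (conjp la i - conjp nu i)%N.
rewrite (@telescope_qb _ _ x) => [|i i0|i i0]; last 2 first.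
- rewrite /x !count_mem_conjp; have := S i i0; have := S i.+1 isT; lia.
- by rewrite /x count_mem_conjp; have := S i i0; lia.
rewrite big_nat_recr //=.
have -> : x M.+2 = 0%N by rewrite /x (conjp_head sla) //; lia.
rewrite ph0 qb0; last exact: tvar_unit.
rewrite !mulr1 {1}(diff_raise c jsM) size_down qbs_down.
have -> : x 1%N = c by rewrite /x -mE conjp1_raise // addKn.
by congr (_ / _); apply: eq_big_nat => i _; rewrite /x mE.
Qed.

(** * The ring of the theorem *)

Notation tK := (tvar%:P : Qttheta).

Section PolyField.
Context (F : fieldType) (u : F).

Lemma polyC_gcoef s : u != 0 ->
  (1 - u^-1)%:P * (u ^+ s.+1)%:P = (u%:P : {poly F}) ^+ s.+1 - u%:P ^+ s.
Proof.
move=> u0; rewrite -!rmorphXn /= -polyCM -polyCB; congr (_%:P).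
by rewrite mulrBl mul1r exprS mulKf.
Qed.

Lemma polyC_unit : u != 0 -> (u%:P : {poly F}) \is a GRing.unit.
Proof. by move=> u0; rewrite poly_unitE size_polyC u0 coefC /= unitfE. Qed.

Lemma ph_polyC r : ph (u%:P : {poly F}) r = (ph u r)%:P.
Proof.
rewrite /ph rmorph_prod; apply: eq_bigr => k _.
by rewrite rmorphB rmorph1 rmorphXn.
Qed.

Lemma qb_polyC m j : qb (u%:P : {poly F}) m j = (qb u m j)%:P.
Proof.
rewrite /qb; case: leqP => _; last by rewrite polyC0.
by rewrite !ph_polyC -polyCM polyCV -polyCM.
Qed.

Lemma qbs_polyC ms js : qbs (u%:P : {poly F}) ms js = (qbs u ms js)%:P.
Proof.
elim: ms js => [|m ms IH] [|j js] //=; rewrite ?polyC1 //.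
by rewrite qb_polyC IH -polyCM.
Qed.
End PolyField.

Lemma tvar_neq0 : tvar != 0.
Proof. by rewrite tofrac_eq0 polyX_eq0. Qed.

Lemma gcoef_gc c s : gcoef c s = gc tK c s.
Proof.
case: s => [|s]; first by [].
by rewrite /gcoef /gc polyC_gcoef ?tvar_neq0.
Qed.

Lemma tK_unit k : 1 - tK ^+ k.+1 \is a GRing.unit.
Proof.
by rewrite -rmorphXn /= -polyC1 -polyCB polyC_unit // tvar_exp_neq1.
Qed.

Lemma two_unit : (2%:R : Qttheta) \is a GRing.unit.
Proof.
rewrite -polyC_natr polyC_unit // -(rmorph_nat (@tofrac {poly rat})) tofrac_eq0.
by rewrite -polyC_natr polyC_eq0.
Qed.

Lemma vzE : @vz Qttheta = vgen.
Proof. by []. Qed.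

Lemma VIterm_term al e : VIterm al e = term vgen (gcoef theta) (gcoef 1) al e.
Proof. rewrite /VIterm /term /ecoef /vmon. reflexivity. Qed.

Lemma VI_term al : VI al = \sum_(e \in [set: expo * expo]) term vgen (gcoef theta) (gcoef 1) al e.
Proof. rewrite /VI. apply: eq_fsbigr => e _. exact: VIterm_term. Qed.

Lemma finite_term al :
  finite_set [set e | term vgen (gcoef theta) (gcoef 1) al e != 0].
Proof.
apply: sub_finite_set (VIterm_finite al) => e /=.
by rewrite VIterm_term.
Qed.

Lemma VI_foldr (B : int -> Lam -> Lam) :
  (forall m, {morph B m : x y / x + y}) -> (forall m c x, B m (c *: x) = c *: B m x) ->
  (forall m, B m 1 = vgen m) ->
  (forall m (k : int) x N, (k < N%:Z)%R -> B m (vgen k * x) =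
        \sum_(a < N) \sum_(b < N) (gc tK theta a * gc tK 1 b) *:
          (vgen (k - a%:Z - b%:Z) * B (m - a%:Z + b%:Z) x)) ->
  forall la, VI (ivec_of la) = foldr (fun (m : nat) x => B m%:Z x) 1 la.
Proof.
move=> BD BZ B1 Bv la; rewrite VI_term.
apply: (@sum_term _ _ vgen (gcoef theta) (gcoef 1) B (erefl _) (fun=> erefl _)
  (erefl _) (erefl _) BD BZ B1 _ finite_term).
move=> m k x N kN; rewrite (Bv m k x N kN).
by apply: eq_bigr => a _; apply: eq_bigr => b _; rewrite !gcoef_gc.
Qed.

Lemma VI_operators : exists (W : seq nat -> Lam) (D U : nat -> Lam -> Lam),
  [/\ forall la, VI (ivec_of la) = W la,
      (forall a, linear (D a)) /\ (forall b, linear (U b)),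
      forall r x, W (nseq r 1%N) * x =
        \sum_(a < r.+1) (theta ^+ a * (phi r)%:P) *: U (r - a)%N (D a x),
      forall a b x, \sum_(i < (minn a b).+1)
          ((-1) ^+ i * (tvar ^+ 'C(i, 2) / phi i)%:P) *: D (a - i)%N (U (b - i)%N x)
        = U b (D a x) &
      (forall a ms, D a (W (mpart ms)) =
        \sum_(js <- choices ms | sumn js == a) (qbs tvar ms js)%:P *: W (mpart (lower 0 ms js))) /\
      (forall b ms, U b (W (mpart ms)) =
        \sum_(js <- choices ms | (sumn js <= b)%N)
          (qbs tvar ms js / ph tvar (b - sumn js))%:P *: W (mpart (raise (b - sumn js) ms js)))].
Proof.
have := @vertex_operators _ tK theta _ _ _ (erefl _) (fun=> erefl _) (@subst_vZ _) (@coef_subst_v _)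
  (coef0_H (@Lam_ind _) (@subst_vZ _) (@coef_subst_v _)) (coef_HC (@Lam_ind _) (@subst_vZ _) (@coef_subst_v _))
  tK_unit two_unit.
rewrite vzE => -[B [D [U [[BD BZ B1 Bv] [DL UL EW DU [DW UW]]]]]].
exists (fun la => foldr (fun (m : nat) x => B m%:Z x) 1 la), D, U.
split; last split.
- exact: VI_foldr.
- by split.
- move=> r x; rewrite EW; apply: eq_bigr => a _.
  by rewrite ph_polyC mulrC.
- move=> a b x; rewrite -DU; apply: eq_bigr => i _.
  by rewrite ph_polyC polyCM polyCV rmorphXn mulrA.
- move=> a ms; rewrite DW; apply: eq_bigr => js _.
  by rewrite qbs_polyC.
- move=> b ms; rewrite UW; apply: eq_bigr => js _.
  by rewrite qbs_polyC ph_polyC polyCM polyCV.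
Qed.

Lemma linear_sum (R : nzRingType) (V V' : lmodType R) (f : V -> V') I (r : seq I)
    (P : pred I) (c : I -> R) (x : I -> V) : linear f ->
  f (\sum_(i <- r | P i) c i *: x i) = \sum_(i <- r | P i) c i *: f (x i).
Proof.
move=> fL; have f0 : f 0 = 0.
  by have := fL 1 0 0; rewrite !scale1r addr0 => /eqP; rewrite -subr_eq0 opprD addNKr oppr_eq0 => /eqP.
elim: r => [|i r IH]; first by rewrite !big_nil.
by rewrite !big_cons; case: (P i); rewrite // fL IH.
Qed.

Lemma mul_polyC_swap (R : comNzRingType) (c : {poly R}) x y :
  c * x%:P * y%:P = c * (y * x)%:P.
Proof. by rewrite -mulrA -polyCM mulrC [x * y]mulrC mulrC. Qed.

Lemma mul_polyC_rot (R : comNzRingType) (c : {poly R}) x y z :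
  c * (x * z)%:P * y%:P = c * (x * y * z)%:P.
Proof. by rewrite -mulrA -polyCM mulrAC. Qed.

Lemma mul_polyC_down_up (R : comNzRingType) (c : {poly R}) p x y z :
  c * p%:P * (x * y * z)%:P = c * (x * p * y * z)%:P.
Proof. by rewrite !polyCM; ring. Qed.

Lemma mul_polyC_up_down (R : comNzRingType) (c s : {poly R}) p q u x y z :
  c * p%:P * (s * (u * q)%:P) * (x * y * z)%:P
  = s * c * (u * (p * q) * x * y * z)%:P.
Proof. by rewrite !polyCM; ring. Qed.

(** * Expansion of D and U over vertical strips *)

Section Expansions.
Context (V : lmodType Qttheta) (W : seq nat -> V) (D U : nat -> V -> V).
Hypothesis DL : forall a, linear (D a).
Hypothesis UL : forall b, linear (U b).
Hypothesis DW : forall a ms, D a (W (mpart ms)) =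
  \sum_(js <- choices ms | sumn js == a) (qbs tvar ms js)%:P *: W (mpart (lower 0 ms js)).
Hypothesis UW : forall b ms, U b (W (mpart ms)) =
  \sum_(js <- choices ms | (sumn js <= b)%N)
    (qbs tvar ms js / ph tvar (b - sumn js))%:P *: W (mpart (raise (b - sumn js) ms js)).

Lemma mpart_mults_head (mu : intpart) : mpart (mults (head 0%N mu) mu) = mu.
Proof.
have /andP[smu mu0] : sorted geq mu && (0%N \notin (mu : seq nat)) := valP mu.
by apply: mpart_mults => // x; apply: le_head.
Qed.

Lemma intpart_head (mu : intpart) x : x \in (mu : seq nat) -> (x <= head 0%N mu)%N.
Proof. by have /andP[smu _] := valP mu; apply: le_head. Qed.

Lemma D_expansion c a (mu : intpart) : c *: D a (W mu) =
  \sum_(nu \in [set nu : intpart | vstrip a mu nu]%classic) (c * (fcoef mu nu a)%:P) *: W nu.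
Proof.
rewrite (sum_vstrip_lower a (fun nu => (c * (fcoef mu nu a)%:P) *: W nu) (@intpart_head mu)).
rewrite -{1}[partval mu]mpart_mults_head DW scaler_sumr big_seq_cond [RHS]big_seq_cond.
apply: eq_bigr => js /andP[jsM /eqP<-]; rewrite scalerA fcoef_lower //.
Qed.

Lemma U_expansion c b (nu : intpart) : c *: U b (W nu) =
  \sum_(la \in [set la : intpart | vstrip b la nu]%classic)
     (c * (bpart nu / bpart la * fcoef la nu b)%:P) *: W la.
Proof.
rewrite (sum_vstrip_raise b (fun la => (c * (bpart nu / bpart la * fcoef la nu b)%:P) *: W la)
  (@intpart_head nu)).
rewrite -{1}[partval nu]mpart_mults_head UW scaler_sumr big_seq_cond [RHS]big_seq_cond.
apply: eq_bigr => js /andP[jsM le].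
pose la := mpart (raise (b - sumn js) (mults (head 0%N nu) nu) js).
have CR : bpart nu / bpart la * fcoef la nu b
    = qbs tvar (mults (head 0%N nu) nu) js / ph tvar (b - sumn js).
  by rewrite -(coef_raise (b - sumn js) jsM) (subnKC le).
by rewrite scalerA -CR.
Qed.

Lemma UD_expansion c a b (mu : intpart) : c *: U b (D a (W mu)) =
  \sum_(nu \in [set nu : intpart | vstrip a mu nu]%classic)
    \sum_(la \in [set la : intpart | vstrip b la nu]%classic)
      (c * (bpart nu / bpart la * fcoef la nu b * fcoef mu nu a)%:P) *: W la.
Proof.
pose G (nu : seq nat) := (c * (fcoef mu nu a)%:P) *: U b (W nu).
transitivity (\sum_(nu \in [set nu : intpart | vstrip a mu nu]%classic) G nu).
  rewrite (sum_vstrip_lower a G (@intpart_head mu)).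
  rewrite -[D a _]scale1r D_expansion.
  rewrite (sum_vstrip_lower a (fun nu => (1 * (fcoef mu nu a)%:P) *: W nu) (@intpart_head mu)).
  rewrite (linear_sum _ _ _ _ (UL b)) scaler_sumr; apply: eq_bigr => js _.
  by rewrite scalerA mul1r.
apply: eq_fsbigr => nu _.
apply: eq_trans (U_expansion _ _ _) _; apply: eq_fsbigr => la _.
exact: (congr1 (fun z => z *: W la) (mul_polyC_swap c _ _)).
Qed.

Lemma DU_expansion c a b (mu : intpart) : c *: D a (U b (W mu)) =
  \sum_(xi \in [set xi : intpart | vstrip b xi mu]%classic)
    \sum_(la \in [set la : intpart | vstrip a xi la]%classic)
      (c * (bpart mu / bpart xi * fcoef xi la a * fcoef xi mu b)%:P) *: W la.
Proof.
pose G (xi : seq nat) := (c * (bpart mu / bpart xi * fcoef xi mu b)%:P) *: D a (W xi).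
transitivity (\sum_(xi \in [set xi : intpart | vstrip b xi mu]%classic) G xi).
  rewrite (sum_vstrip_raise b G (@intpart_head mu)).
  rewrite -[U b _]scale1r U_expansion.
  rewrite (sum_vstrip_raise b (fun xi => (1 * (bpart mu / bpart xi * fcoef xi mu b)%:P) *: W xi)
    (@intpart_head mu)).
  rewrite (linear_sum _ _ _ _ (DL a)) scaler_sumr; apply: eq_bigr => js _.
  by rewrite scalerA mul1r.
apply: eq_fsbigr => xi _.
apply: eq_trans (D_expansion _ _ _) _; apply: eq_fsbigr => la _.
exact: (congr1 (fun z => z *: W la) (mul_polyC_rot c _ _ _)).
Qed.
End Expansions.

Local Open Scope classical_set_scope.
Unset Implicit Arguments.

Theorem theoremB (r : nat) (mu : intpart) (hr : (1 <= r)%N) :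
  VI (ivec_of mu) * VI (ivec_of (nseq r 1%N)) =
    \sum_(a < r.+1) \sum_(b < r.+1 | (a + b == r)%N)
      \sum_(nu \in [set nu : intpart | vstrip a mu nu])
        \sum_(la \in [set la : intpart | vstrip b la nu])
          (theta ^+ a *
           (bpart nu / bpart la * phi r * fcoef la nu b * fcoef mu nu a)%:P)
          *: VI (ivec_of la)
  /\
  VI (ivec_of mu) * VI (ivec_of (nseq r 1%N)) =
    \sum_(a < r.+1) \sum_(b < r.+1 | (a + b == r)%N)
      \sum_(i < (minn a b).+1)
        \sum_(xi \in [set xi : intpart | vstrip (b - i) xi mu])
          \sum_(la \in [set la : intpart | vstrip (a - i) xi la])
            ((-1) ^+ i * theta ^+ a *
             (tvar ^+ (i * (i - 1) %/ 2) * (phi r / phi i) *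
              (bpart mu / bpart xi) *
              fcoef xi la (a - i) * fcoef xi mu (b - i))%:P)
            *: VI (ivec_of la).
Proof.
have [W [D [U [VIE [DL UL] EW DU [DW UW]]]]] := VI_operators.
have E : VI (ivec_of mu) * VI (ivec_of (nseq r 1%N)) =
    \sum_(a < r.+1) \sum_(b < r.+1 | (a + b == r)%N)
      (theta ^+ a * (phi r)%:P) *: U b (D a (W mu)).
  rewrite !VIE mulrC EW; apply: eq_bigr => a _.
  have br : (r - a < r.+1)%N by rewrite ltnS leq_subr.
  (* The condition [a + b = r] leaves the single value [b = r - a]. *)
  rewrite (big_pred1 (Ordinal br)) // => b.
  by rewrite /= -val_eqE /=; have := ltn_ord a; lia.
rewrite E; split; apply: eq_bigr => a _; apply: eq_bigr => b _.
  apply: eq_trans (UD_expansion UL DW UW _ _ _ _) _.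
  apply: eq_fsbigr => nu _; apply: eq_fsbigr => la _; rewrite VIE.
  exact: (congr1 (fun z => z *: W la) (mul_polyC_down_up (theta ^+ a) _ _ _ _)).
(* For the up-down rule [U b (D a _)] is replaced by the alternating combination of
   [D (a - i) (U (b - i) _)], so that boxes are added before any are removed. *)
apply: eq_trans (congr1 (fun z => (theta ^+ a * (phi r)%:P) *: z) (esym (DU _ _ _))) _.
apply: eq_trans (scaler_sumr _ _ _ _) _; apply: eq_bigr => i _.
apply: eq_trans (scalerA _ _ _) _.
apply: eq_trans (DU_expansion DL DW UW _ _ _ _) _.
apply: eq_fsbigr => xi _; apply: eq_fsbigr => la _; rewrite VIE.
have -> : (i * (i - 1) %/ 2)%N = 'C(i, 2) by rewrite bin2 divn2 subn1.
exact: (congr1 (fun z => z *: W la) (mul_polyC_up_down (theta ^+ a) ((-1) ^+ i) _ _ _ _ _ _)).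
Qed.
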